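(* Let $\beta>0$ and $\gamma\ge 0$ be arbitrary parameters. Then there exist positive constants $C=C(\beta,\gamma)$ (depending only on $\beta,\gamma$) and $\alpha=\alpha(\gamma)$ (depending only on $\gamma$) such that the following holds. For every $N$, let $\bar Y=(Y_1,\dots,Y_N)\in[0,1]^N$ be a random vector with density $$f_{\bar Y}(\bar y)=\frac1{Z_N}\exp\Big(-\sum_{i=1}^{N}\Big(\frac{\beta}{2y_i}+\frac{\gamma}{y_i+y_{i+1}}\Big)\Big),\qquad Z_N=\int_{[0,1]^N}\exp\Big(-\sum_{i=1}^{N}\Big(\frac{\beta}{2y_i}+\frac{\gamma}{y_i+y_{i+1}}\Big)\Big)d\bar y,$$ where indices are taken modulo $N$ (so $y_{N+1}=y_1$). Let $I,J\subset\{1,\dots,N\}$ be non-empty disjoint sets of (cyclically) consecutive indices. Then $$\Big|f_{\bar Y_I\mid \bar Y_J=\bar y_J}(\bar y_I)-f_{\bar Y_I}(\bar y_I)\Big|\le C e^{-\alpha\, r(I,J)}\,f_{\bar Y_I}(\bar y_I)$$ for any $\bar y_I\in[0,1]^{|I|}$ and $\bar y_J\in[0,1]^{|J|}$. Furthermore, $\alpha(\gamma)\to\infty$ as $\gamma\to0$.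
   Context: Indices $1,\dots,N$ are placed on a circle: $1$ and $N$ are neighbours, all indices are understood modulo $N$, and sets of consecutive indices are allowed to wrap around from $N$ to $1$. For $J\subset\{1,\dots,N\}$, $\bar Y_J:=(Y_j)_{j\in J}$, and $f_{\bar Y_J}$ denotes its marginal density. $f_{\bar Y_I\mid\bar Y_J=\bar y_J}$ denotes the conditional density of $\bar Y_I$ given $\bar Y_J=\bar y_J$, that is, the joint density of $(\bar Y_I,\bar Y_J)$ at $(\bar y_I,\bar y_J)$ divided by $f_{\bar Y_J}(\bar y_J)$ (meaningful where $f_{\bar Y_J}(\bar y_J)>0$). The density $f_{\bar Y}$ is read as $0$ when some $y_i=0$. For non-empty disjoint sets $I,J$ of consecutive indices, the complement $\{1,\dots,N\}\setminus(I\cup J)$ consists of two (possibly empty) sets of consecutive indices lying between $I$ and $J$ on the circle; $r(I,J)$ is the cardinality of the smaller of these two sets, i.e. the smallest number of consecutive indices separating $I$ and $J$. *)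

(* Defs.v *)
From mathcomp Require Import all_boot all_order all_algebra.
From mathcomp Require Import all_classical all_reals all_analysis.

Set Implicit Arguments.
Unset Strict Implicit.
Unset Printing Implicit Defensive.

Import Order.TTheory GRing.Theory Num.Theory.
Import numFieldNormedType.Exports.

Local Open Scope classical_set_scope.
Local Open Scope ring_scope.

(* The indices 1, ..., N placed on a circle are represented by 'I_N; the
   successor of i is [ordS i], with value i.+1 %% N. *)

Section circle.
Variable N : nat.
Implicit Types I J : {set 'I_N}.

Definition consecutive I : Prop :=
  exists (a : 'I_N) (k : nat), I = [set iter h (@ordS N) a | h : 'I_k]%SET.

(* Number of steps i |-> i + 1 leading from x to y around the circle. *)
Definition cdist (x y : 'I_N) : nat := ((y + (N - x)) %% N)%N.

(* The indices outside I and J from which, moving forward, one meets J before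
   I.  For non-empty disjoint sets I, J of consecutive indices,
   [gap I J] and [gap J I] are the two sets of consecutive indices that make up
   the complement of I :|: J. *)
Definition gap I J : {set 'I_N} :=
  [set x in ~: (I :|: J) |
    [exists j in J, [forall i in I, (cdist x j < cdist x i)%N]]]%SET.

Definition separation I J : nat := minn #|gap I J| #|gap J I|.

End circle.

Section density.
Variables (R : realType) (N : nat).
Implicit Types (f : ('I_N -> R) -> R) (y : 'I_N -> R) (I J : {set 'I_N}).

(* Integral of f over [0, 1] in each of the coordinates listed in s, the other
   coordinates being kept equal to those of y.  It is written as an iterated
   integral; the functions f used below are nonnegative, bounded and Borel, so
   that the order of integration is irrelevant. *)
Definition integrate_out (s : seq 'I_N) f : ('I_N -> R) -> R :=
  foldr (fun i g y =>
    \int[lebesgue_measure]_(t in `[0, 1]) g [eta y with i |-> t]) f s.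

Variables beta gamma : R.

(* The case distinction implements exp(- oo) = 0 when some coordinate is 0. *)
Definition weight y : R :=
  if [forall i, 0 < y i] then
    expR (- \sum_(i < N) (beta / (2 * y i) + gamma / (y i + y (ordS i))))
  else 0.

Definition partition_function : R :=
  integrate_out (enum 'I_N) weight (fun=> 0).

Definition density y : R := weight y / partition_function.

(* Only the coordinates of y in J matter. *)
Definition marginal J y : R := integrate_out (enum (~: J)) density y.

(* For disjoint I and J; only the coordinates of y in I :|: J matter.
   Meaningful only when [marginal J y] is positive. *)
Definition conditional I J y : R := marginal (I :|: J) y / marginal J y.

End density.

(* Main.v *)
Require Import Defs.
From mathcomp Require Import all_boot all_order all_algebra.
From mathcomp Require Import all_classical all_reals all_analysis.
From mathcomp Require Import measurable_realfun zify ring lra.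

Import Order.TTheory GRing.Theory Num.Theory.
Import numFieldNormedType.Exports.

Set Implicit Arguments.
Unset Strict Implicit.
Unset Printing Implicit Defensive.

Local Open Scope ring_scope.

(** Put [b = beta / 2] and let [T f x = \int a(t) K(x + t) f(t) dt] be the
    transfer operator of the chain, with [a(t) = exp (- b / t)] and
    [K(t) = exp (- gamma / t)].  Since [K] is nondecreasing,
    [K t <= K (x + t) <= 1], so [T (T f)] lies between [m * \int a f] and
    [M * \int a f], with [m = \int a(t) exp (- 2 gamma / t) dt] and
    [M = \int a].  As [a] is nondecreasing it does not favour small [t], whence
    [m >= theta * M] with [theta] depending only on [gamma] and [theta --> 1] as
    [gamma --> 0].  Hence two steps of [T] shrink the oscillation of a ratio
    [T^n f1 / T^n f2] by the factor [1 - theta].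

    Let [F] be the unnormalized marginal of [I :|: J], and [M_I], [M_J] those of
    [I] and [J].  Introducing an independent copy [v] of the coordinates,
    [F(y) Z] is the integral over [v] of [F(y_I, y_J) F(v_I, v_J)], and
    [M_I(y) M_J(y)] that of [F(y_I, v_J) F(v_I, y_J)].  The quotient of the
    integrands is a product of two cross ratios of [T^p K] and [T^q K], where
    [p] and [q] are the lengths of the two gaps.  For separation at most 1, only
    [F(y) Z <= theta^-4 M_I(y) M_J(y)] is needed: exchanging the two copies
    outside [I] affects just the two bonds leaving [I], and the loss is a
    function of at most four coordinates of [v], each costing a factor [theta]
    because the weight is nondecreasing in every coordinate. *)

(** * Integration over the unit interval *)

Section unit_interval_integral.
Variable R : realType.
Implicit Types f g : R -> R.

Let mu : {measure set (measurableTypeR R) -> \bar R} := @lebesgue_measure R.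
Let D : set R := (`[0, 1])%classic.

Lemma measurable_unit_itv : measurable D.
Proof. exact: measurable_itv. Qed.

Lemma lebesgue_measure_unit_itv : mu D = 1%E.
Proof.
apply: (eq_trans (lebesgue_measure_itv `[0%R, 1%R])).
by rewrite /= lte_fin ltr01 -EFinB subr0.
Qed.

Definition integral01 f : R := \int[mu]_(t in D) f t.

Definition bmeas f := measurable_fun setT f /\ exists B, forall t, `|f t| <= B.

Lemma bmeas_integrable f : bmeas f -> mu.-integrable D (EFin \o f).
Proof.
move=> [mf [B hB]]; apply: measurable_bounded_integrable.
- exact: measurable_unit_itv.
- by rewrite lebesgue_measure_unit_itv ltry.
- exact: measurable_funTS.
- exists B; split; first exact: num_real.
  by move=> x Bx t _ /=; exact: le_trans (hB t) (ltW Bx).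
Qed.

Lemma bmeas01 f : measurable_fun setT f -> (forall t, 0 <= f t <= 1) -> bmeas f.
Proof.
by move=> mf f01; split=> //; exists 1 => t; case/andP: (f01 t) => f0 f1; rewrite ger0_norm.
Qed.

Lemma bmeasM f g : bmeas f -> bmeas g -> bmeas (fun t => f t * g t).
Proof.
move=> [mf [B hB]] [mg [B' hB']]; split; first exact: measurable_funM.
by exists (B * B') => t; rewrite normrM ler_pM.
Qed.

Lemma bmeas_cst (c : R) : bmeas (fun=> c).
Proof. by split; [exact: measurable_cst | exists `|c|]. Qed.

Lemma bmeasD f g : bmeas f -> bmeas g -> bmeas (fun t => f t + g t).
Proof.
move=> [mf [B hB]] [mg [B' hB']]; split; first exact: measurable_funD.
by exists (B + B') => t; rewrite (le_trans (ler_normD _ _))// lerD.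
Qed.

Lemma integral01Z c f : bmeas f -> integral01 (fun t => c * f t) = c * integral01 f.
Proof.
by move=> bf; apply: RintegralZl; [exact: measurable_unit_itv | exact: bmeas_integrable].
Qed.

Lemma integral01D f g : bmeas f -> bmeas g ->
  integral01 (fun t => f t + g t) = integral01 f + integral01 g.
Proof.
by move=> bf bg; apply: RintegralD; [exact: measurable_unit_itv | exact: bmeas_integrable..].
Qed.

Lemma le_integral01 f g : bmeas f -> bmeas g ->
  (forall t, 0 <= t <= 1 -> f t <= g t) -> integral01 f <= integral01 g.
Proof.
move=> bf bg fg; apply: le_Rintegral; [exact: measurable_unit_itv | exact: bmeas_integrable..|].
by move=> t; rewrite /D/= in_itv/=; exact: fg.
Qed.

Lemma integral01_cst c : integral01 (fun=> c) = c.
Proof.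
rewrite /integral01 Rintegral_cst ?lebesgue_measure_unit_itv ?mulr1//.
exact: measurable_unit_itv.
Qed.

Lemma integral01_ge0 f : (forall t, 0 <= t <= 1 -> 0 <= f t) -> 0 <= integral01 f.
Proof.
by move=> f0; apply: Rintegral_ge0 => t; rewrite /D/= in_itv/=; exact: f0.
Qed.

Lemma integral01_itv f : measurable_fun setT f -> (forall t, 0 <= f t <= 1) ->
  0 <= integral01 f <= 1.
Proof.
move=> mf f01; apply/andP; split.
  by apply: integral01_ge0 => t _; case/andP: (f01 t).
rewrite -[leRHS]integral01_cst; apply: le_integral01; [exact: bmeas01|exact: bmeas_cst|].
by move=> t _; case/andP: (f01 t).
Qed.

Section parametric.
Context d (T : measurableType d).
Variable h : T * (measurableTypeR R) -> R.
Hypothesis mh : measurable_fun setT h.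
Hypothesis h01 : forall z, 0 <= h z <= 1.

(** Tonelli's theorem concerns extended-real integrals over the whole line, so the restriction to
    [0, 1] is moved into the integrand. *)
Definition cutoff (z : T * (measurableTypeR R)) : \bar R := (h z * \1_D z.2)%:E.

Lemma measurable_cutoff : measurable_fun setT cutoff.
Proof.
apply/measurable_EFinP; apply: measurable_funM => //.
have mI : measurable_fun setT (\1_D : measurableTypeR R -> R).
  by apply: measurable_indic; exact: measurable_unit_itv.
exact: (measurableT_comp mI measurable_snd).
Qed.

Lemma cutoff_ge0 z : (0 <= cutoff z)%E.
Proof. by rewrite lee_fin mulr_ge0//; case/andP: (h01 z). Qed.

Lemma EFin_integral01 t : (integral01 (fun s => h (t, s)))%:E = (\int[mu]_s cutoff (t, s))%E.
Proof.
have bh : bmeas (fun s => h (t, s)).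
  by apply: bmeas01 => //; exact: (measurableT_comp mh (measurable_pair1 t)).
rewrite /integral01 /Rintegral fineK; last first.
  by apply: integrable_fin_num; [exact: measurable_unit_itv|exact: bmeas_integrable].
rewrite integral_mkcond; apply: eq_integral => s _.
rewrite /cutoff/= patchE indicE; by case: ifP; rewrite ?mulr1 ?mulr0.
Qed.

Lemma measurable_integral01 : measurable_fun setT (fun t => integral01 (fun s => h (t, s))).
Proof.
apply/measurable_EFinP.
rewrite (_ : _ \o _ = fubini_F mu cutoff); last by apply/funext => t; exact: EFin_integral01.
by apply: measurable_fun_fubini_tonelli_F; [exact: measurable_cutoff|exact: cutoff_ge0].
Qed.

End parametric.

Lemma integral01_swap (h : R -> R -> R) :
  measurable_fun setT (fun z : measurableTypeR R * measurableTypeR R => h z.1 z.2) ->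
  (forall s t, 0 <= h s t <= 1) ->
  integral01 (fun s => integral01 (h s)) = integral01 (fun t => integral01 (h ^~ t)).
Proof.
move=> mh h01.
pose k (z : measurableTypeR R * measurableTypeR R) := h z.1 z.2 * \1_D z.1 * \1_D z.2.
have mI : measurable_fun setT (\1_D : measurableTypeR R -> R).
  by apply: measurable_indic; exact: measurable_unit_itv.
have mk : measurable_fun setT (EFin \o k).
  apply/measurable_EFinP; apply: measurable_funM; first apply: measurable_funM => //.
  - exact: (measurableT_comp mI measurable_fst).
  - exact: (measurableT_comp mI measurable_snd).
have k0 z : (0 <= (EFin \o k) z)%E.
  by rewrite lee_fin !mulr_ge0//; case/andP: (h01 z.1 z.2).
(* Applied to [h] and to its transpose, this brings both iterated integrals to the form in which
   Tonelli's theorem exchanges them. *)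
have half (g : R -> R -> R) :
    measurable_fun setT (fun z : measurableTypeR R * measurableTypeR R => g z.1 z.2) ->
    (forall s t, 0 <= g s t <= 1) ->
    (integral01 (fun s => integral01 (g s)))%:E =
    (\int[mu]_s \int[mu]_t (g s t * \1_D s * \1_D t)%:E)%E.
  move=> mg g01.
  have mG := @measurable_integral01 _ (measurableTypeR R) _ mg (fun z => g01 z.1 z.2).
  have mG2 : measurable_fun setT
      (fun z : measurableTypeR R * measurableTypeR R => integral01 (g z.2)).
    exact: (measurableT_comp mG measurable_snd).
  (* The outer integral has no parameter; a dummy one, set to 0, makes the parametric lemma
     applicable. *)
  rewrite (@EFin_integral01 _ (measurableTypeR R) _ mG2 _ 0); last first.
    move=> z; apply: integral01_itv => //.
    exact: (measurableT_comp mg (measurable_pair1 z.2)).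
  apply: eq_integral => s _; rewrite /cutoff/= indicE.
  case: (s \in D); rewrite ?mulr1 ?mulr0.
    rewrite (@EFin_integral01 _ (measurableTypeR R) _ mg (fun z => g01 z.1 z.2) s).
    by apply: eq_integral => t _; rewrite mulr1.
  by rewrite integral0_eq// => t _; rewrite mulr0 mul0r.
have h01' t s : 0 <= h s t <= 1 by exact: h01.
apply: EFin_inj; rewrite (half _ mh h01) (half (fun t s => h s t) _ h01'); last first.
  apply: (measurableT_comp mh (_ : measurable_fun setT
    (fun z : measurableTypeR R * measurableTypeR R => (z.2, z.1)))).
  by apply: measurable_fun_pair; [exact: measurable_snd|exact: measurable_fst].
rewrite (fubini_tonelli (EFin \o k) mk k0).
by apply: eq_integral => t _; apply: eq_integral => s _; rewrite /k/= mulrAC.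
Qed.

Lemma integral01_step (delta : R) : 0 < delta < 1 ->
  integral01 (fun t => (delta <= t)%R%:R) = 1 - delta.
Proof.
move=> /andP[d0 d1]; rewrite /integral01 /Rintegral.
rewrite (_ : (\int[mu]_(t in D) _)%E = (\int[mu]_(t in D) (\1_(`[delta, +oo[%classic) t)%:E)%E).
  rewrite integral_indic//; last exact: measurable_unit_itv.
  rewrite (_ : _ `&` _ = `[delta, 1])%classic.
    rewrite [mu _](lebesgue_measure_itv `[delta, 1])/= lte_fin d1 -EFinB.
    by [].
  apply/seteqP; split=> t; rewrite /D/= !in_itv/= ?andbT.
    by case=> ? /andP[_ ->]; rewrite andbT.
  by move=> /andP[dt ->]; rewrite dt (le_trans (ltW d0) dt).
by apply: eq_integral => t _; rewrite indicE mem_setE in_itv/= andbT.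
Qed.

End unit_interval_integral.

(** * The repulsion factor exp (- c / t) *)

Section repulsion.
Variable R : realType.
Implicit Types (c t delta : R) (h : R -> R).

(** The value 0 for t <= 0 matches exp (- oo) = 0 in [weight] and keeps the function nondecreasing
    on all of [R] for every c >= 0. *)
Definition expinv c t : R := if 0 < t then expR (- (c / t)) else 0.

Lemma expinv_ge0 c t : 0 <= expinv c t.
Proof. by rewrite /expinv; case: ifP => // _; exact: expR_ge0. Qed.

Lemma expinv_gt0 c t : 0 < t -> 0 < expinv c t.
Proof. by rewrite /expinv => ->; exact: expR_gt0. Qed.

Lemma expinv_le1 c t : 0 <= c -> expinv c t <= 1.
Proof.
move=> c0; rewrite /expinv; case: ifP => // t0.
by rewrite -expR0 ler_expR oppr_le0 divr_ge0// ltW.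
Qed.

Lemma expinv_itv c t : 0 <= c -> 0 <= expinv c t <= 1.
Proof. by move=> c0; rewrite expinv_ge0 expinv_le1. Qed.

Lemma le_expinv c : 0 <= c -> {homo expinv c : s t / s <= t}.
Proof.
move=> c0 s t st; rewrite {1}/expinv; case: ifP => s0; last exact: expinv_ge0.
have t0 := lt_le_trans s0 st.
by rewrite /expinv t0 ler_expR lerN2 ler_wpM2l// lef_pV2 ?posrE.
Qed.

Lemma expinvD c c' t : expinv (c + c') t = expinv c t * expinv c' t.
Proof.
by rewrite /expinv; case: ifP => _; rewrite ?mulr0// mulrDl opprD expRD.
Qed.

Lemma measurable_expinv c : 0 <= c -> measurable_fun setT (expinv c).
Proof. by move=> c0; apply: nondecreasing_measurable => //; exact: le_expinv. Qed.

Lemma bmeas_expinv c : 0 <= c -> bmeas (expinv c).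
Proof.
by move=> c0; apply: bmeas01; [exact: measurable_expinv|move=> t; exact: expinv_itv].
Qed.

(** The mass share 1 - delta of [delta, 1], times the least value of [expinv c] there. *)
Definition contrast delta c : R := (1 - delta) * expR (- (c / delta)).

Lemma contrast_itv delta c : 0 <= c -> 0 < delta < 1 -> 0 < contrast delta c < 1.
Proof.
move=> c0 /andP[d0 d1]; rewrite /contrast.
have e0 := expR_gt0 (- (c / delta)).
have e1 : expR (- (c / delta)) <= 1.
  by rewrite -expR0 ler_expR oppr_le0 divr_ge0// ltW.
rewrite mulr_gt0 ?subr_gt0//=; nra.
Qed.

(* h carries at least the fraction 1 - delta of its mass on [delta, 1], because
   it is at most h delta before delta and at least h delta after it. *)
Lemma integral01_tilt delta c h : 0 <= c -> 0 < delta < 1 ->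
  bmeas h -> (forall t, 0 <= h t) -> {homo h : s t / s <= t} ->
  contrast delta c * integral01 h <= integral01 (fun t => h t * expinv c t).
Proof.
move=> c0 /andP[d0 d1] bh h0 hm.
pose chi t : R := (delta <= t)%R%:R.
have bchi : bmeas chi.
  apply: bmeas01; last by move=> t; rewrite /chi; case: (delta <= t); rewrite ?lexx ?ler01.
  apply: nondecreasing_measurable => // s t st; rewrite /chi ler_nat.
  by case: (leP delta s) => // ds; rewrite (le_trans ds st).
set e := expR (- (c / delta)).
have e0 : 0 <= e := expR_ge0 _.
have cheb : (1 - delta) * integral01 h <= integral01 (fun t => h t * chi t).
  (* Chebyshev's argument: right side minus left side is (h t - h delta) * (chi t - (1 - delta)),
     whose factors never have opposite signs. The terms in h delta integrate to 0. *)
  have : integral01 (fun t => (1 - delta) * h t + (h delta * chi t + (- h delta * (1 - delta))))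
      <= integral01 (fun t => h t * chi t).
    apply: le_integral01.
    - apply: bmeasD; first by apply: bmeasM => //; exact: bmeas_cst.
      by apply: bmeasD; [apply: bmeasM => //; exact: bmeas_cst|exact: bmeas_cst].
    - exact: bmeasM.
    - move=> t _; rewrite /chi; case: (leP delta t) => dt /=.
        by have := hm _ _ dt; nra.
      by have := hm _ _ (ltW dt); nra.
  rewrite integral01D; last 2 first.
  - by apply: bmeasM => //; exact: bmeas_cst.
  - by apply: bmeasD; [apply: bmeasM => //; exact: bmeas_cst|exact: bmeas_cst].
  rewrite integral01D ?integral01Z ?integral01_cst ?integral01_step ?d0//.
  - by rewrite mulNr subrr addr0.
  - exact: bmeas_cst.
  - by apply: bmeasM => //; exact: bmeas_cst.
  - exact: bmeas_cst.
rewrite /contrast -/e [_ * e]mulrC -mulrA.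
apply: le_trans (ler_wpM2l e0 cheb) _.
rewrite -integral01Z; last exact: bmeasM.
apply: le_integral01.
- by apply: bmeasM; [exact: bmeas_cst|exact: bmeasM].
- by apply: bmeasM => //; exact: bmeas_expinv.
move=> t _; rewrite mulrCA ler_wpM2l// /chi; case: (leP delta t) => dt /=.
  rewrite mulr1; apply: le_trans (le_expinv c0 dt).
  by rewrite /expinv d0.
by rewrite mulr0 expinv_ge0.
Qed.

End repulsion.

(** * Contraction of the transfer operator *)

Section transfer.
Variables (R : realType) (b gamma delta : R).
Hypotheses (b0 : 0 <= b) (gamma0 : 0 <= gamma) (delta01 : 0 < delta < 1).
Implicit Types f : R -> R.

Definition unitfun f := measurable_fun setT f /\ forall t, 0 <= f t <= 1.

Lemma bmeas_unitfun f : unitfun f -> bmeas f.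
Proof. by case=> mf f01; exact: bmeas01. Qed.

Lemma unitfun_ge0 f t : unitfun f -> 0 <= f t.
Proof. by case=> _ /(_ t) /andP[]. Qed.

Definition transfer f x : R :=
  integral01 (fun t => expinv b t * expinv gamma (x + t) * f t).

Definition mass f : R := integral01 (fun t => expinv b t * f t).

Lemma measurable_kernel :
  measurable_fun setT (fun z : measurableTypeR R * measurableTypeR R => expinv gamma (z.1 + z.2)).
Proof.
apply: (measurableT_comp (measurable_expinv gamma0)).
by apply: measurable_funD; [exact: measurable_fst|exact: measurable_snd].
Qed.

Lemma unitfun_kernel x : unitfun (fun t => expinv gamma (x + t)).
Proof.
split=> [|t]; last exact: expinv_itv.
apply: (measurableT_comp (measurable_expinv gamma0)).
by apply: measurable_funD => //; exact: measurable_cst.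
Qed.

Lemma unitfun_kernelC z : unitfun (fun x => expinv gamma (x + z)).
Proof. by under eq_fun do rewrite addrC; exact: unitfun_kernel. Qed.

Lemma unitfunM f g : unitfun f -> unitfun g -> unitfun (fun t => f t * g t).
Proof.
move=> [mf f01] [mg g01]; split=> [|t]; first exact: measurable_funM.
case/andP: (f01 t) => f0 f1; case/andP: (g01 t) => g0 g1.
by rewrite mulr_ge0//= mulr_ile1.
Qed.

Lemma unitfun_expinv c : 0 <= c -> unitfun (expinv c).
Proof. by move=> c0; split; [exact: measurable_expinv|move=> t; exact: expinv_itv]. Qed.

Lemma unitfun_transfer f : unitfun f -> unitfun (transfer f).
Proof.
move=> uf; have [mf f01] := uf; split=> [|x]; last first.
  suff [mg g01] : unitfun (fun t => expinv b t * expinv gamma (x + t) * f t).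
    exact: integral01_itv.
  by apply: unitfunM => //; apply: unitfunM; [exact: unitfun_expinv|exact: unitfun_kernel].
pose h (z : measurableTypeR R * measurableTypeR R) :=
  expinv b z.2 * expinv gamma (z.1 + z.2) * f z.2.
apply: (@measurable_integral01 R _ (measurableTypeR R) h); last first.
  move=> [x t]; rewrite /h/=; case/andP: (expinv_itv t b0) => ? ?.
  case/andP: (expinv_itv (x + t) gamma0) => ? ?; case/andP: (f01 t) => ? ?.
  by rewrite !mulr_ge0//= !mulr_ile1// mulr_ge0.
apply: measurable_funM; last exact: (measurableT_comp mf measurable_snd).
apply: measurable_funM; last exact: measurable_kernel.
exact: (measurableT_comp (measurable_expinv b0) measurable_snd).
Qed.

Lemma bmeas_transfer_integrand f x : unitfun f ->
  bmeas (fun t => expinv b t * expinv gamma (x + t) * f t).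
Proof.
move=> uf; apply: bmeas_unitfun; apply: unitfunM => //.
by apply: unitfunM; [exact: unitfun_expinv|exact: unitfun_kernel].
Qed.

Lemma bmeas_mass_integrand f : unitfun f -> bmeas (fun t => expinv b t * f t).
Proof.
by move=> uf; apply: bmeas_unitfun; apply: unitfunM => //; exact: unitfun_expinv.
Qed.

Section combination.
Variables (u v : R) (f1 f2 : R -> R).
Hypotheses (uf1 : unitfun f1) (uf2 : unitfun f2).

(** Linear combinations are treated because the contraction argument applies T to f1 - lo * f2 and
    hi * f2 - f1, which need not take values in [0, 1]. *)
Lemma transfer_comb x : u * transfer f1 x + v * transfer f2 x =
  integral01 (fun t => expinv b t * expinv gamma (x + t) * (u * f1 t + v * f2 t)).
Proof.
have b1 := bmeas_transfer_integrand x uf1; have b2 := bmeas_transfer_integrand x uf2.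
rewrite /transfer -!integral01Z// -integral01D; first by congr integral01; apply/funext => t; ring.
- by apply: bmeasM => //; exact: bmeas_cst.
- by apply: bmeasM => //; exact: bmeas_cst.
Qed.

Lemma mass_comb : u * mass f1 + v * mass f2 =
  integral01 (fun t => expinv b t * (u * f1 t + v * f2 t)).
Proof.
have b1 := bmeas_mass_integrand uf1; have b2 := bmeas_mass_integrand uf2.
rewrite /mass -!integral01Z// -integral01D; first by congr integral01; apply/funext => t; ring.
- by apply: bmeasM => //; exact: bmeas_cst.
- by apply: bmeasM => //; exact: bmeas_cst.
Qed.

Lemma bmeas_comb : bmeas (fun t => u * f1 t + v * f2 t).
Proof.
by apply: bmeasD; (apply: bmeasM; [exact: bmeas_cst|exact: bmeas_unitfun]).
Qed.

Hypothesis comb0 : forall t, 0 < t -> 0 <= u * f1 t + v * f2 t.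

(** Ratios are controlled only at t > 0, whence the restricted sign hypothesis; elsewhere [expinv b]
    vanishes. *)
Lemma expinv_comb_ge0 t : 0 <= expinv b t * (u * f1 t + v * f2 t).
Proof.
case: (ltP 0 t) => t0; first by rewrite mulr_ge0 ?expinv_ge0 ?comb0.
by rewrite /expinv ltNge t0 mul0r.
Qed.

Lemma mass_comb_ge0 : 0 <= u * mass f1 + v * mass f2.
Proof. by rewrite mass_comb; apply: integral01_ge0 => t _; exact: expinv_comb_ge0. Qed.

Lemma transfer_comb_bounds x : 0 <= x ->
  expinv gamma x * (u * mass f1 + v * mass f2) <= u * transfer f1 x + v * transfer f2 x
    <= u * mass f1 + v * mass f2.
Proof.
move=> x0; rewrite mass_comb transfer_comb.
have bc := bmeas_comb.
have bb := bmeas_expinv b0; have bk := bmeas_unitfun (unitfun_kernel x).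
apply/andP; split.
  rewrite -integral01Z; last exact: bmeasM.
  apply: le_integral01 => [||t /andP[t0 _]].
  - by apply: bmeasM; [exact: bmeas_cst|exact: bmeasM].
  - by apply: bmeasM => //; exact: bmeasM.
  rewrite -[leRHS]mulrA [leRHS]mulrCA ler_wpM2r ?expinv_comb_ge0//.
  by apply: le_expinv => //; rewrite lerDl.
apply: le_integral01 => [||t _]; [by apply: bmeasM => //; exact: bmeasM|exact: bmeasM|].
rewrite -[leLHS]mulrA [leLHS]mulrCA ler_piMl ?expinv_comb_ge0//.
exact: expinv_le1.
Qed.

End combination.

(** After one step the lower bound still depends on the point, through [expinv gamma]. Integrating
    it against the second kernel, itself at least [expinv gamma t], leaves a constant; the two
    factors merge into [expinv (gamma + gamma)]. *)
Lemma transfer2_comb_bounds u v f1 f2 x : unitfun f1 -> unitfun f2 ->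
  (forall t, 0 < t -> 0 <= u * f1 t + v * f2 t) -> 0 <= x ->
  mass (expinv (gamma + gamma)) * (u * mass f1 + v * mass f2)
    <= u * transfer (transfer f1) x + v * transfer (transfer f2) x
    <= mass (fun=> 1) * (u * mass f1 + v * mass f2).
Proof.
move=> uf1 uf2 comb0 x0; have m0 := mass_comb_ge0 uf1 uf2 comb0.
have [uT1 uT2] := (unitfun_transfer uf1, unitfun_transfer uf2).
have bb := bmeas_expinv b0; have bg := bmeas_expinv gamma0.
have bk := bmeas_unitfun (unitfun_kernel x).
set c := u * mass f1 + v * mass f2 in m0 *.
have bT : bmeas (fun t => u * transfer f1 t + v * transfer f2 t).
  by apply: bmeasD; (apply: bmeasM; [exact: bmeas_cst|exact: bmeas_unitfun]).
have bbT := bmeasM bb bT.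
have T_bounds t : 0 <= t -> expinv gamma t * c <= u * transfer f1 t + v * transfer f2 t <= c.
  by move=> t0; have := transfer_comb_bounds uf1 uf2 comb0 t0.
have T_ge0 t : 0 <= t -> 0 <= u * transfer f1 t + v * transfer f2 t.
  move=> t0; have /andP[lo _] := T_bounds _ t0; apply: le_trans lo.
  by rewrite mulr_ge0// expinv_ge0.
rewrite transfer_comb// !(mulrC _ c) /mass -!integral01Z; last 2 first.
- by apply: bmeasM => //; exact: bmeas_cst.
- by apply: bmeasM => //; apply: bmeas_expinv; exact: addr_ge0.
apply/andP; split; apply: le_integral01.
- apply: bmeasM; first exact: bmeas_cst.
  by apply: bmeasM => //; apply: bmeas_expinv; exact: addr_ge0.
- by apply: bmeasM => //; exact: bmeasM.
- move=> t /andP[t0 _]; have /andP[lo _] := T_bounds _ t0.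
  rewrite expinvD mulrCA -mulrA ler_wpM2l ?expinv_ge0//.
  rewrite mulrC -mulrA; apply: ler_pM => //; rewrite ?expinv_ge0//.
    by rewrite mulr_ge0// expinv_ge0.
  by apply: le_expinv => //; rewrite lerDr.
- by apply: bmeasM => //; exact: bmeasM.
- apply: bmeasM; first exact: bmeas_cst.
  by apply: bmeasM => //; exact: bmeas_cst.
- move=> t /andP[t0 _]; have /andP[_ hi] := T_bounds _ t0.
  rewrite mulr1 [leRHS]mulrC -mulrA ler_wpM2l ?expinv_ge0//.
  by rewrite -[leRHS]mul1r; apply: ler_pM; rewrite ?expinv_ge0 ?expinv_le1 ?T_ge0.
Qed.


(** Lower bound, free of [b], for the quotient of the two constants in [transfer2_comb_bounds]. *)
Definition theta : R := contrast delta (gamma + gamma).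

Lemma theta_itv : 0 < theta < 1.
Proof. by apply: contrast_itv => //; rewrite addr_ge0. Qed.

Lemma mass1_gt0 : 0 < mass (fun=> 1).
Proof.
have /andP[c0 _] := contrast_itv b0 delta01.
apply: lt_le_trans c0 _.
have := integral01_tilt b0 delta01 (bmeas_cst 1) (fun=> ler01) (fun _ _ _ => lexx 1).
rewrite integral01_cst mulr1 => /le_trans; apply.
by rewrite /mass; under eq_fun do rewrite mulrC.
Qed.

Lemma theta_mass1 : theta * mass (fun=> 1) <= mass (expinv (gamma + gamma)).
Proof.
rewrite (_ : mass (fun=> 1) = integral01 (expinv b)); last first.
  by congr integral01; apply/funext => t; rewrite mulr1.
apply: integral01_tilt => //; first by rewrite addr_ge0.
- exact: bmeas_expinv.
- by move=> t; exact: expinv_ge0.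
- exact: le_expinv.
Qed.


(** The first two steps confine the ratio to an interval with hi / lo = theta^-2; each further pair
    of steps multiplies the relative width by at most 1 - theta. *)
Definition gap_error k : R := theta^-2 * (1 - theta) ^+ k.

Section contraction.
Variables f1 f2 : R -> R.
Hypotheses (uf1 : unitfun f1) (uf2 : unitfun f2).
Hypotheses (m1 : 0 < mass f1) (m2 : 0 < mass f2).

Lemma transfer2_bounds f x : unitfun f -> 0 <= x ->
  theta * mass (fun=> 1) * mass f <= transfer (transfer f) x <= mass (fun=> 1) * mass f.
Proof.
move=> uf x0.
have comb0 t : 0 < t -> 0 <= 1 * f t + 0 * f t.
  by rewrite mul1r mul0r addr0 unitfun_ge0.
have := transfer2_comb_bounds uf uf comb0 x0.
rewrite !mul1r !mul0r !addr0 => /andP[].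
move=> lo ->; rewrite andbT; apply: le_trans lo; rewrite ler_wpM2r ?theta_mass1//.
by apply: integral01_ge0 => t _; rewrite mulr_ge0 ?expinv_ge0 ?unitfun_ge0.
Qed.

Lemma mass_transfer2_gt0 f : unitfun f -> 0 < mass f -> 0 < mass (transfer (transfer f)).
Proof.
move=> uf mf; have /andP[th0 _] := theta_itv; have M0 := mass1_gt0.
apply: (@lt_le_trans _ _ ((theta * mass (fun=> 1) * mass f) * mass (fun=> 1))).
  apply: mulr_gt0 => //; apply: mulr_gt0 => //. exact: mulr_gt0.
have bb := bmeas_expinv b0.
rewrite /mass -integral01Z; last by apply: bmeasM => //; exact: bmeas_cst.
apply: le_integral01 => [||t /andP[t0 _]].
- apply: bmeasM; first exact: bmeas_cst.
  by apply: bmeasM => //; exact: bmeas_cst.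
- by apply: bmeas_mass_integrand; do 2 apply: unitfun_transfer.
have /andP[lo _] := transfer2_bounds uf t0.
by rewrite mulr1 mulrC ler_wpM2l ?expinv_ge0.
Qed.

(** Two steps turn any f into a function lying between theta * M * mass f and M * mass f, so the
    ratio stays within a factor theta of the quotient q of the masses. *)
Lemma ratio_transfer2 : exists lo hi, [/\ 0 < lo, hi - lo <= gap_error 0 * lo &
  forall x, 0 < x -> lo * transfer (transfer f2) x <= transfer (transfer f1) x
    <= hi * transfer (transfer f2) x].
Proof.
have /andP[th0 th1] := theta_itv; have M0 := mass1_gt0.
pose q := mass f1 / mass f2.
have q0 : 0 < q by rewrite divr_gt0.
have qE : mass f1 = q * mass f2 by rewrite divfK ?gt_eqF.
exists (theta * q), (theta^-1 * q); split=> [||x /ltW x0].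
- by rewrite mulr_gt0.
- rewrite /gap_error expr0 mulr1 -subr_ge0.
  rewrite (_ : _ - _ = theta * q); last by field; exact: lt0r_neq0.
  by rewrite mulr_ge0// ltW.
have /andP[lo1 hi1] := transfer2_bounds uf1 x0.
have /andP[lo2 hi2] := transfer2_bounds uf2 x0.
apply/andP; split.
  apply: le_trans lo1; rewrite qE.
  rewrite (_ : theta * _ * _ = theta * q * (mass (fun=> 1) * mass f2)); last by ring.
  by rewrite ler_wpM2l// mulr_ge0// ltW.
apply: le_trans hi1 _; rewrite qE.
rewrite (_ : mass (fun=> 1) * _ =
  theta^-1 * q * (theta * mass (fun=> 1) * mass f2)); last by field; exact: lt0r_neq0.
by rewrite ler_wpM2l// mulr_ge0// ?invr_ge0 ltW.
Qed.

(** The nonnegative function f1 - lo * f2 has mass (q - lo) * mass f2, so two steps lift it above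
    theta * (q - lo) times the image of f2; the same holds for hi * f2 - f1 with hi - q. The
    endpoints move inward by theta * (hi - lo) in total, and lo does not decrease. *)
Lemma contract_transfer2 lo hi eps : 0 <= eps -> 0 < lo -> hi - lo <= eps * lo ->
  (forall x, 0 < x -> lo * f2 x <= f1 x <= hi * f2 x) ->
  exists lo' hi', [/\ 0 < lo', hi' - lo' <= (1 - theta) * eps * lo' &
    forall x, 0 < x -> lo' * transfer (transfer f2) x <= transfer (transfer f1) x
      <= hi' * transfer (transfer f2) x].
Proof.
move=> eps0 lo0 hieps f12.
have /andP[th0 th1] := theta_itv; have M0 := mass1_gt0.
have lo_f t : 0 < t -> 0 <= 1 * f1 t + - lo * f2 t.
  by move=> /f12/andP[+ _]; rewrite mul1r mulNr subr_ge0.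
have hi_f t : 0 < t -> 0 <= -1 * f1 t + hi * f2 t.
  by move=> /f12/andP[_ +]; rewrite mulN1r addrC subr_ge0.
have lo_m := mass_comb_ge0 uf1 uf2 lo_f.
pose q := mass f1 / mass f2.
have qE : mass f1 = q * mass f2 by rewrite divfK ?gt_eqF.
have lo_q : lo <= q.
  by rewrite -(ler_pM2r m2) -qE -subr_ge0; rewrite mul1r mulNr in lo_m.
exists (lo + theta * (q - lo)), (hi - theta * (hi - q)); split=> [||x x0].
- by nra.
- apply: (@le_trans _ _ ((1 - theta) * (hi - lo))).
    by rewrite le_eqVlt; apply/orP; left; apply/eqP; ring.
  rewrite -mulrA ler_wpM2l ?subr_ge0 ?(ltW th1)//.
  apply: le_trans hieps _.
  by rewrite ler_wpM2l// lerDl mulr_ge0 ?subr_ge0// ltW.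
have /andP[lo_lo _] := transfer2_comb_bounds uf1 uf2 lo_f (ltW x0).
have /andP[hi_lo _] := transfer2_comb_bounds uf1 uf2 hi_f (ltW x0).
have /andP[_ hi2] := transfer2_bounds uf2 (ltW x0).
have hi_m := mass_comb_ge0 uf1 uf2 hi_f.
have thM := theta_mass1.
(* Compares the lower bound for a combination of mass u * mass f2 with the upper bound for the image
   of f2; their constants differ by a factor at least theta. *)
have key u : 0 <= u -> theta * u * transfer (transfer f2) x <=
    mass (expinv (gamma + gamma)) * (u * mass f2).
  move=> u0; apply: (@le_trans _ _ (theta * u * (mass (fun=> 1) * mass f2))).
    by rewrite ler_wpM2l// mulr_ge0// ltW.
  rewrite (_ : theta * u * _ = theta * mass (fun=> 1) * (u * mass f2)); last by ring.
  by rewrite ler_wpM2r// mulr_ge0// ltW.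
have q_hi : q <= hi.
  by rewrite -(ler_pM2r m2) -qE -subr_ge0; rewrite mulN1r addrC in hi_m.
apply/andP; split.
  have := key (q - lo); rewrite subr_ge0 => /(_ lo_q).
  move: lo_lo; rewrite qE (_ : 1 * _ + - lo * mass f2 = (q - lo) * mass f2); last by ring.
  move=> h1 h2; have := le_trans h2 h1.
  by rewrite mul1r mulNr lerBrDl -mulrDl.
have := key (hi - q); rewrite subr_ge0 => /(_ q_hi).
move: hi_lo; rewrite qE (_ : -1 * _ + hi * mass f2 = (hi - q) * mass f2); last by ring.
move=> h1 h2; have := le_trans h2 h1.
by rewrite mulN1r [X in _ <= X]addrC lerBrDr -lerBrDl -mulrBl.
Qed.

End contraction.


Lemma gap_error_ge0 k : 0 <= gap_error k.
Proof.
have /andP[th0 th1] := theta_itv.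
by rewrite /gap_error mulr_ge0 ?invr_ge0 ?exprn_ge0 ?subr_ge0 ?ltW.
Qed.

Lemma unitfun_iter_transfer n f : unitfun f -> unitfun (iter n transfer f).
Proof. by move=> uf; elim: n => [//|n ih]; exact: unitfun_transfer. Qed.

Lemma ratio_iter_transfer k f1 f2 : unitfun f1 -> unitfun f2 ->
    0 < mass f1 -> 0 < mass f2 ->
  exists lo hi, [/\ 0 < lo, hi - lo <= gap_error k * lo &
    forall x, 0 < x -> lo * iter k.+1.*2 transfer f2 x <= iter k.+1.*2 transfer f1 x
      <= hi * iter k.+1.*2 transfer f2 x].
Proof.
elim: k f1 f2 => [|k ih] f1 f2 uf1 uf2 m1 m2; first exact: ratio_transfer2.
have [lo [hi [lo0 le f12]]] := ih _ _ uf1 uf2 m1 m2.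
have m n f : unitfun f -> 0 < mass f -> 0 < mass (iter n.*2 transfer f).
  move=> uf mf; elim: n => [//|n ihn]; rewrite doubleS/=.
  by apply: mass_transfer2_gt0 => //; exact: unitfun_iter_transfer.
have := contract_transfer2 (unitfun_iter_transfer k.+1.*2 uf1)
  (unitfun_iter_transfer k.+1.*2 uf2) (m k.+1 _ uf2 m2) (gap_error_ge0 k) lo0 le f12.
by rewrite {1}/gap_error mulrCA -exprS -/(gap_error k.+1).
Qed.

(** Stated for a single step because the steps preceding the last 2 (k + 1) may be odd in number.
    The image is at least [expinv gamma] times mass f, and tilting bounds the mass of [expinv gamma]
    from below. *)
Lemma mass_transfer_gt0 f : unitfun f -> 0 < mass f -> 0 < mass (transfer f).
Proof.
move=> uf mf; have bf := bmeas_mass_integrand uf.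
have /andP[c0 _] := contrast_itv gamma0 delta01.
apply: (@lt_le_trans _ _ (mass f * (contrast delta gamma * mass (fun=> 1)))).
  by apply: mulr_gt0 => //; apply: mulr_gt0 => //; exact: mass1_gt0.
have bb := bmeas_expinv b0; have bg := bmeas_expinv gamma0.
apply: (@le_trans _ _ (mass f * mass (expinv gamma))).
  rewrite ler_wpM2l ?(ltW mf)//.
  rewrite (_ : mass (fun=> 1) = integral01 (expinv b)); last first.
    by congr integral01; apply/funext => t; rewrite mulr1.
  apply: integral01_tilt => // [t|]; first exact: expinv_ge0.
  exact: le_expinv.
rewrite {2 3}/mass -integral01Z; last exact: bmeasM.
apply: le_integral01 => [||t /andP[t0 _]].
- by apply: bmeasM; [exact: bmeas_cst|exact: bmeasM].
- by apply: bmeas_mass_integrand; exact: unitfun_transfer.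
have comb0 s : 0 < s -> 0 <= 1 * f s + 0 * f s.
  by rewrite mul1r mul0r addr0 unitfun_ge0.
have := transfer_comb_bounds uf uf comb0 t0.
rewrite !mul1r !mul0r !addr0 => /andP[lo _].
by rewrite mulrCA ler_wpM2l ?expinv_ge0// mulrC.
Qed.

(** Total weight of p free sites between fixed ends x and z: p site factors and p + 1 bonds, without
    the site factors of the ends. *)
Definition path_weight p x z : R := iter p transfer (fun t => expinv gamma (t + z)) x.

(** As functions of the starting point, the path weights to z and z' arise by 2 (k + 1) transfer
    steps from functions of positive mass. Their ratio at x therefore exceeds the one at x' by at
    most the factor hi / lo <= 1 + gap_error k. *)
Lemma path_weight_cross p k x x' z z' : (k.+1.*2 <= p)%N ->
    0 < x -> 0 < x' -> 0 < z -> 0 < z' ->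
  path_weight p x z * path_weight p x' z'
    <= (1 + gap_error k) * (path_weight p x' z * path_weight p x z').
Proof.
move=> kp x0 x'0 z0 z'0.
have M0 := mass1_gt0.
have mK u : 0 < u -> 0 < mass (fun t => expinv gamma (t + u)).
  move=> u0; apply: (@lt_le_trans _ _ (expinv gamma u * mass (fun=> 1))).
    by apply: mulr_gt0 => //; exact: expinv_gt0.
  have bb := bmeas_expinv b0.
  rewrite /mass -integral01Z; last by apply: bmeasM => //; exact: bmeas_cst.
  apply: le_integral01 => [||t /andP[t0 _]].
  - apply: bmeasM; first exact: bmeas_cst.
    by apply: bmeasM => //; exact: bmeas_cst.
  - by apply: bmeas_mass_integrand; exact: unitfun_kernelC.
  by rewrite mulr1 mulrC ler_wpM2l ?expinv_ge0//; apply: le_expinv => //; rewrite lerDr.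
pose f u := iter (p - k.+1.*2) transfer (fun t => expinv gamma (t + u)).
have uf u : unitfun (f u) by apply: unitfun_iter_transfer; exact: unitfun_kernelC.
have mf u : 0 < u -> 0 < mass (f u).
  move=> u0; rewrite /f; elim: (p - _)%N => [|n ihn]; first exact: mK.
  by apply: mass_transfer_gt0 => //; apply: unitfun_iter_transfer; exact: unitfun_kernelC.
have pwE y u : path_weight p y u = iter k.+1.*2 transfer (f u) y.
  by rewrite /path_weight /f -iterD subnKC.
have [lo [hi [lo0 le ratio]]] := ratio_iter_transfer k (uf z) (uf z') (mf _ z0) (mf _ z'0).
rewrite !pwE.
have /andP[_ hx] := ratio _ x0; have /andP[hx' _] := ratio _ x'0.
have ge0 y u : 0 <= iter k.+1.*2 transfer (f u) y.
  by apply: unitfun_ge0; exact: unitfun_iter_transfer.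
have a0 := ge0 x z'; have b0' := ge0 x' z'.
set A := iter _ _ (f z) x in hx *; set B := iter _ _ (f z') x' in hx' b0' *.
set A' := iter _ _ (f z) x' in hx' *; set B' := iter _ _ (f z') x in hx a0 *.
clearbody A B A' B'.
apply: (@le_trans _ _ (hi * B' * B)); first exact: ler_wpM2r.
apply: (@le_trans _ _ ((1 + gap_error k) * (lo * B * B'))).
  rewrite -mulrA (_ : (1 + _) * _ = (1 + gap_error k) * lo * (B' * B)); last by ring.
  rewrite ler_wpM2r ?mulr_ge0//.
  by rewrite mulrDl mul1r -lerBlDl.
by rewrite ler_wpM2l ?addr_ge0 ?gap_error_ge0// ler_wpM2r.
Qed.

End transfer.

(** * Iterated integrals *)

Section iterated_integral.
Variables (R : realType) (N : nat).
Implicit Types (f g c : ('I_N -> R) -> R) (y v : 'I_N -> R) (i j : 'I_N) (s : seq 'I_N).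

Local Notation upd y i t := [eta y with i |-> t].

(* Joint measurability, phrased so that no sigma-algebra on 'I_N -> R is needed. *)
Definition jointly_measurable f := forall d (T : measurableType d) (phi : 'I_N -> T -> R),
  (forall i, measurable_fun setT (phi i)) -> measurable_fun setT (fun t => f (phi ^~ t)).

Definition unitmfun f := jointly_measurable f /\ forall y, 0 <= f y <= 1.

Lemma integrate_out_cons i s f y :
  integrate_out (i :: s) f y = integral01 (fun t => integrate_out s f (upd y i t)).
Proof. by []. Qed.

Lemma integrate_out_cat s1 s2 f :
  integrate_out (s1 ++ s2) f = integrate_out s1 (integrate_out s2 f).
Proof. by rewrite /integrate_out foldr_cat. Qed.

Lemma unitmfun_ge0 f y : unitmfun f -> 0 <= f y.
Proof. by case=> _ /(_ y) /andP[]. Qed.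

Lemma unitmfunM f g : unitmfun f -> unitmfun g -> unitmfun (fun y => f y * g y).
Proof.
move=> [mf f01] [mg g01]; split=> [d T phi mphi|y].
  by apply: measurable_funM; [exact: mf|exact: mg].
case/andP: (f01 y) => f0 f1; case/andP: (g01 y) => g0 g1.
by rewrite mulr_ge0//= mulr_ile1.
Qed.

Lemma unitmfun_cst (c : R) : 0 <= c <= 1 -> unitmfun (fun=> c).
Proof. by move=> c01; split=> // d T phi mphi; exact: measurable_cst. Qed.

Lemma unitmfun_prod (I : Type) (r : seq I) (P : pred I) (F : I -> ('I_N -> R) -> R) :
  (forall k, unitmfun (F k)) -> unitmfun (fun y => \prod_(k <- r | P k) F k y).
Proof.
move=> uF; elim: r => [|k r ih].
  by under eq_fun do rewrite big_nil; apply: unitmfun_cst; rewrite lexx ler01.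
under eq_fun do rewrite big_cons; case: (P k) => //; exact: unitmfunM.
Qed.

Lemma measurable_upd d (T : measurableType d) (phi : 'I_N -> T -> R) i :
  (forall j, measurable_fun setT (phi j)) ->
  forall j, measurable_fun setT
    (fun z : T * measurableTypeR R => (upd (phi ^~ z.1) i z.2) j).
Proof.
move=> mphi j; rewrite /=; case: (j == i); first exact: measurable_snd.
exact: (measurableT_comp (mphi j) measurable_fst).
Qed.

Lemma unitfun_section f y i : unitmfun f -> unitfun (fun t => f (upd y i t)).
Proof.
move=> [mf f01]; split=> [|t]; last exact: f01.
apply: (mf _ (measurableTypeR R) (fun j t => (upd y i t) j)) => j /=.
by case: (j == i); [exact: measurable_id|exact: measurable_cst].
Qed.

Lemma unitmfun_integral01 f i : unitmfun f ->
  unitmfun (fun y => integral01 (fun t => f (upd y i t))).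
Proof.
move=> uf; have [mf f01] := uf; split=> [d T phi mphi|y]; last first.
  by have [] := unitfun_section y i uf; exact: integral01_itv.
pose h (z : T * measurableTypeR R) := f (upd (phi ^~ z.1) i z.2).
apply: (@measurable_integral01 R _ T h) => [|z]; last exact: f01.
apply: (mf _ _ (fun j z => (upd (phi ^~ z.1) i z.2) j)).
exact: measurable_upd.
Qed.

Lemma unitmfun_integrate_out s f : unitmfun f -> unitmfun (integrate_out s f).
Proof. by move=> uf; elim: s => [//|i s ih]; exact: unitmfun_integral01. Qed.

Lemma bmeas_section s f y i : unitmfun f ->
  bmeas (fun t => integrate_out s f (upd y i t)).
Proof.
by move=> uf; apply: bmeas_unitfun; apply: unitfun_section; exact: unitmfun_integrate_out.
Qed.

Lemma le_integrate_out s f g y : unitmfun f -> unitmfun g ->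
  (forall v, f v <= g v) -> integrate_out s f y <= integrate_out s g y.
Proof.
move=> uf ug fg; elim: s y => [|i s ih] y; first exact: fg.
by apply: le_integral01 => [||t _]; [exact: bmeas_section..|exact: ih].
Qed.

Lemma eq_integrate_out s f g y : f =1 g -> integrate_out s f y = integrate_out s g y.
Proof. by move=> fg; have -> : f = g by exact/funext. Qed.

Lemma upd_comm y i j (t u : R) : i != j ->
  upd (upd y i t) j u = upd (upd y j u) i t :> ('I_N -> R).
Proof.
move=> ij; apply/funext => k /=; case: eqP => // ->; case: eqP => // ji.
by rewrite ji eqxx in ij.
Qed.

Definition independent_of s c := forall y i (t : R), i \in s -> c (upd y i t) = c y.

Lemma integrate_outZ s c f y : unitmfun f -> independent_of s c ->
  integrate_out s (fun v => c v * f v) y = c y * integrate_out s f y.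
Proof.
move=> uf; elim: s y => [//|i s ih] y ci.
rewrite !integrate_out_cons -integral01Z; last exact: bmeas_section.
congr integral01; apply/funext => t; rewrite ih ?ci ?mem_head// => v j u js.
by rewrite ci// in_cons js orbT.
Qed.

Lemma integrate_outZ_cst s (a : R) f y : unitmfun f ->
  integrate_out s (fun v => a * f v) y = a * integrate_out s f y.
Proof. by move=> uf; exact: (@integrate_outZ s (fun=> a)). Qed.

Lemma integrate_out_swap i j f y : unitmfun f ->
  integrate_out [:: i; j] f y = integrate_out [:: j; i] f y.
Proof.
move=> uf; have [->//|ij] := eqVneq i j.
have [mf f01] := uf.
change (integral01 (fun t => integral01 (fun u => f (upd (upd y i t) j u))) =
  integral01 (fun u => integral01 (fun t => f (upd (upd y j u) i t)))).
rewrite integral01_swap => [||t u]; last exact: f01.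
  congr integral01; apply/funext => u; congr integral01; apply/funext => t.
  by rewrite upd_comm.
apply: (mf _ _ (fun k (z : measurableTypeR R * measurableTypeR R) =>
  (upd (upd y i z.1) j z.2) k)) => k.
by rewrite /=; case: (k == j); [exact: measurable_snd|]; case: (k == i);
  [exact: measurable_fst|exact: measurable_cst].
Qed.

(** Obtained from adjacent exchanges along [s]. Applied to a prefix of a list, it moves one
    integration to any place, which yields invariance under permutations. *)
Lemma integrate_out_rot1 s i f : unitmfun f ->
  integrate_out (i :: s) f =1 integrate_out (rcons s i) f.
Proof.
move=> uf; elim: s => [//|j s ih] y.
have us := unitmfun_integrate_out s uf.
rewrite -[i :: j :: s]/([:: i; j] ++ s) integrate_out_cat integrate_out_swap//.
rewrite -integrate_out_cat /= -/(integral01 _); congr integral01.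
by apply/funext => t; exact: ih.
Qed.

Lemma perm_integrate_out s1 s2 f y : unitmfun f -> perm_eq s1 s2 ->
  integrate_out s1 f y = integrate_out s2 f y.
Proof.
move=> uf; elim: s1 s2 y => [|i s1 ih] s2 y.
  by move=> /perm_size/esym/eqP; rewrite size_eq0 => /eqP ->.
move=> ps; have /splitPr s2E : i \in s2 by rewrite -(perm_mem ps) mem_head.
case: s2E ps => p q ps.
have ps1 : perm_eq s1 (p ++ q).
  by rewrite -(perm_cons i) (perm_trans ps)// -[i :: q]cat1s perm_catCA.
rewrite -cat_rcons integrate_out_cat.
rewrite -(integrate_out_rot1 _ _ (unitmfun_integrate_out q uf)) -integrate_out_cat.
by rewrite cat_cons !integrate_out_cons; congr integral01; apply/funext => t; exact: ih.
Qed.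

(** Splices two copies: F(y_I, v_J) is [F (mix J v y)] and F(v_I, y_J) is [F (mix I v y)]. *)
Definition mix (J : {set 'I_N}) v y : 'I_N -> R := fun i => if i \in J then v i else y i.

Lemma unitmfun_mix (J : {set 'I_N}) f y : unitmfun f -> unitmfun (fun v => f (mix J v y)).
Proof.
move=> [mf f01]; split=> [d T phi mphi|v]; last exact: f01.
apply: (mf _ _ (fun i t => mix J (phi ^~ t) y i)) => i; rewrite /mix.
by case: (i \in J) => //; exact: measurable_cst.
Qed.

Lemma mix_upd (J : {set 'I_N}) v y i (t : R) :
  i \in J -> mix J (upd v i t) y = upd (mix J v y) i t :> ('I_N -> R).
Proof.
move=> iJ; apply/funext => k; rewrite /mix /=.
by case: eqP => [->|_]; [rewrite iJ|].
Qed.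

Lemma integrate_out_mix (J : {set 'I_N}) s f v y : {subset s <= J} ->
  integrate_out s (fun v => f (mix J v y)) v = integrate_out s f (mix J v y).
Proof.
elim: s v => [//|i s ih] v sJ; rewrite !integrate_out_cons; congr integral01.
apply/funext => t; rewrite ih; first by rewrite mix_upd// sJ// mem_head.
by move=> k ks; apply: sJ; rewrite in_cons ks orbT.
Qed.

Definition nondecreasing_coords f := forall y v, (forall i, y i <= v i) -> f y <= f v.

Lemma nondecreasing_integrate_out s f : unitmfun f -> nondecreasing_coords f ->
  nondecreasing_coords (integrate_out s f).
Proof.
move=> uf nf; elim: s => [//|i s ih] y v yv; rewrite !integrate_out_cons.
apply: le_integral01 => [||t _]; [exact: bmeas_section..|apply: ih => k /=].
by case: ifP.
Qed.

Lemma unitmfun_coord (g : R -> R) i : unitfun g -> unitmfun (fun y => g (y i)).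
Proof.
move=> [mg g01]; split=> [d T phi mphi|y]; last exact: g01.
exact: (measurableT_comp mg (mphi i)).
Qed.

(** Once the coordinate i is reached, the integral over the remaining ones is nondecreasing in t, so
    the one-dimensional tilting applies; by uniqueness i does not occur again and its factor leaves
    the inner integral. *)
Lemma integrate_out_tilt (delta k : R) s f i y : 0 <= k -> 0 < delta < 1 ->
  unitmfun f -> nondecreasing_coords f -> uniq s -> i \in s ->
  contrast delta k * integrate_out s f y
    <= integrate_out s (fun v => f v * expinv k (v i)) y.
Proof.
move=> k0 d01 uf nf; elim: s y => [//|j s ih] y; rewrite cons_uniq => /andP[js us].
have uE := unitmfun_coord i (unitfun_expinv k0).
have ufE := unitmfunM uf uE.
rewrite !integrate_out_cons in_cons; case: (eqVneq i j) js => [<- js _|ij js /= si].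
  apply: (@le_trans _ _ (integral01 (fun t => integrate_out s f (upd y i t) * expinv k t))).
    apply: integral01_tilt => //; first exact: bmeas_section.
    - by move=> t; apply: unitmfun_ge0; exact: unitmfun_integrate_out.
    - move=> t u tu; apply: nondecreasing_integrate_out => // l /=.
      by case: ifP.
  rewrite le_eqVlt; apply/orP; left; apply/eqP; congr integral01; apply/funext => t.
  under [RHS]eq_integrate_out do rewrite mulrC.
  rewrite integrate_outZ//=; first by rewrite eqxx mulrC.
  by move=> v l u ls /=; case: eqP => // il; rewrite il ls in js.
rewrite -integral01Z; last exact: bmeas_section.
apply: le_integral01; [|exact: bmeas_section|].
  by apply: bmeasM; [exact: bmeas_cst|exact: bmeas_section].
by move=> t _; exact: ih.
Qed.

End iterated_integral.

(** * Two independent copies *)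

Section two_copies.
Variables (R : realType) (N : nat).
Implicit Types (f g : ('I_N -> R) -> R) (y v : 'I_N -> R) (A B I J : {set 'I_N}).

Lemma integrate_out_congr s f y v : (forall i, i \notin s -> y i = v i) ->
  integrate_out s f y = integrate_out s f v.
Proof.
elim: s y v => [|i s ih] y v yv.
  by rewrite (_ : y = v)//; apply/funext => i; exact: yv.
rewrite !integrate_out_cons; congr integral01; apply/funext => t; apply: ih => j js /=.
by case: eqP => // /eqP ji; apply: yv; rewrite in_cons negb_or ji.
Qed.

Lemma mixyy A y : mix A y y = y.
Proof. by apply/funext => i; rewrite /mix; case: ifP. Qed.

(** The first factor sees v only on B and the second only on A, so a single variable v can carry
    both integrations. *)
Lemma integrate_out_two_copies A B f g y : unitmfun f -> unitmfun g -> [disjoint A & B] ->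
  integrate_out (enum A ++ enum B) (fun v => f (mix B v y) * g (mix A v y)) y =
  integrate_out (enum B) f y * integrate_out (enum A) g y.
Proof.
move=> uf ug dAB; rewrite integrate_out_cat.
have ufm := unitmfun_mix B y uf; have ugm := unitmfun_mix A y ug.
have -> : integrate_out (enum B) (fun v => f (mix B v y) * g (mix A v y)) =
    (fun v => integrate_out (enum B) f y * g (mix A v y)).
  apply/funext => v; under eq_integrate_out do rewrite mulrC.
  rewrite integrate_outZ//; last first.
    move=> u i t; rewrite mem_enum => iB; congr g; apply/funext => k; rewrite /mix/=.
    by case: ifP => // kA; case: eqP => // ki; move: (disjointFr dAB kA); rewrite ki iB.
  rewrite mulrC; congr (_ * _); rewrite integrate_out_mix; last by move=> k; rewrite mem_enum.
  by apply: integrate_out_congr => i; rewrite mem_enum /mix => /negbTE ->.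
rewrite integrate_outZ_cst//; congr (_ * _).
by rewrite integrate_out_mix ?mixyy// => k; rewrite mem_enum.
Qed.

Lemma perm_enum_cat A B (C : {pred 'I_N}) : [disjoint A & B] ->
    (forall i, (i \in C) = (i \in A) || (i \in B)) ->
  perm_eq (enum A ++ enum B) (enum C).
Proof.
move=> dAB CE; apply: uniq_perm; rewrite ?cat_uniq ?enum_uniq//=.
  rewrite andbT; apply/hasPn => i; rewrite !mem_enum => iB.
  by rewrite (disjointFl dAB iB).
by move=> i; rewrite mem_cat !mem_enum CE.
Qed.

End two_copies.

(** * The weight as a product over sites and bonds *)

Section circle_weight.
Variables (R : realType) (N : nat) (b gamma : R).
Hypotheses (b0 : 0 <= b) (gamma0 : 0 <= gamma).
Implicit Types (y v : 'I_N -> R) (I J : {set 'I_N}).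

Definition bond y i : R := expinv gamma (y i + y (ordS i)).

Definition pweight y : R := \prod_(i < N) (expinv b (y i) * bond y i).

Lemma unitmfun_bond i : unitmfun (fun y => bond y i).
Proof.
split=> [d T phi mphi|y]; last exact: expinv_itv.
apply: (measurableT_comp (measurable_expinv gamma0)).
exact: measurable_funD.
Qed.

Lemma unitmfun_pweight : unitmfun pweight.
Proof.
apply: unitmfun_prod => i; apply: unitmfunM; last exact: unitmfun_bond.
by apply: unitmfun_coord; exact: unitfun_expinv.
Qed.

Lemma pweight_ge0 y : 0 <= pweight y.
Proof. exact: (unitmfun_ge0 _ unitmfun_pweight). Qed.

Lemma pweight_gt0P y i : pweight y != 0 -> 0 < y i.
Proof.
rewrite /pweight prodf_seq_neq0 => /allP/(_ i (mem_index_enum i))/=.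
by rewrite mulf_eq0 negb_or => /andP[+ _]; rewrite /expinv; case: ifP => //; rewrite eqxx.
Qed.

Lemma nondecreasing_pweight : nondecreasing_coords pweight.
Proof.
move=> y v yv; apply: ler_prod => i _.
rewrite mulr_ge0 ?expinv_ge0//=; apply: ler_pM; rewrite ?expinv_ge0//.
  exact: le_expinv.
by apply: le_expinv => //; rewrite lerD.
Qed.

Definition boundary I : {set 'I_N} := [set i | (i \in I) != (ordS i \in I)]%SET.

(** Repetitions are intended: every boundary bond is charged one factor at each end, and a site may
    end two such bonds. *)
Definition boundary_sites I : seq 'I_N :=
  enum (boundary I) ++ map (@ordS N) (enum (boundary I)).

(** Bonds are at most 1, and an exchanged bond is at least the factor of either summand alone: s'
    for s' + t, and t' for s + t'. *)
Lemma swap_bond (s t s' t' : R) : 0 <= s -> 0 <= t ->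
  expinv gamma (s + t) * expinv gamma (s' + t') * (expinv gamma s' * expinv gamma t')
    <= expinv gamma (s + t') * expinv gamma (s' + t).
Proof.
move=> s0 t0; have e := expinv_ge0 gamma; have e1 u := expinv_le1 u gamma0.
apply: (@le_trans _ _ (expinv gamma s' * expinv gamma t')).
  by rewrite ler_piMl ?mulr_ge0// mulr_ile1.
rewrite [leRHS]mulrC; apply: ler_pM => //; apply: le_expinv => //.
  by rewrite lerDl.
by rewrite lerDr.
Qed.

(** Exchanging the copies outside I preserves the product of the two site factors everywhere and of
    the two bonds off the boundary; [swap_bond] handles the boundary. If a weight vanishes the left
    side is 0, otherwise all coordinates are positive. *)
Lemma swap_pweight I y v :
  pweight y * pweight v * \prod_(i <- boundary_sites I) expinv gamma (v i)
    <= pweight (mix (~: I)%SET v y) * pweight (mix I v y).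
Proof.
have [y0|] := eqVneq (pweight y) 0.
  by rewrite y0 !mul0r mulr_ge0 ?pweight_ge0.
have [v0|] := eqVneq (pweight v) 0.
  by rewrite v0 mulr0 mul0r mulr_ge0 ?pweight_ge0.
move=> /pweight_gt0P vp /pweight_gt0P yp.
have -> : \prod_(i <- boundary_sites I) expinv gamma (v i) = \prod_(i < N)
    (if i \in boundary I then expinv gamma (v i) * expinv gamma (v (ordS i)) else 1).
  by rewrite -big_mkcond big_split /boundary_sites big_cat/= big_map !big_enum.
rewrite /pweight -!big_split/=.
apply: ler_prod => i _; apply/andP; split.
  rewrite !mulr_ge0 ?expinv_ge0//; case: ifP => // _.
  by rewrite mulr_ge0// expinv_ge0.
rewrite /bond /boundary finset.in_set /mix !finset.in_setC.
have e := expinv_ge0; have e1 := expinv_le1.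
have sb1 := swap_bond (v i) (v (ordS i)) (ltW (yp i)) (ltW (yp (ordS i))).
have ab0 : 0 <= expinv b (y i) * expinv b (v i) by rewrite mulr_ge0 ?expinv_ge0.
case: (i \in I); case: (ordS i \in I) => /=.
- by rewrite mulr1.
- rewrite [leLHS](_ : _ = expinv b (y i) * expinv b (v i) *
    (expinv gamma (y i + y (ordS i)) * expinv gamma (v i + v (ordS i)) *
    (expinv gamma (v i) * expinv gamma (v (ordS i))))); last by ring.
  rewrite [leRHS](_ : _ = expinv b (y i) * expinv b (v i) *
    (expinv gamma (y i + v (ordS i)) * expinv gamma (v i + y (ordS i)))); last by ring.
  exact: ler_wpM2l.
- rewrite [leLHS](_ : _ = expinv b (y i) * expinv b (v i) *
    (expinv gamma (y i + y (ordS i)) * expinv gamma (v i + v (ordS i)) *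
    (expinv gamma (v i) * expinv gamma (v (ordS i))))); last by ring.
  rewrite [leRHS](_ : _ = expinv b (y i) * expinv b (v i) *
    (expinv gamma (y i + v (ordS i)) * expinv gamma (v i + y (ordS i)))); last by ring.
  exact: ler_wpM2l.
- by rewrite mulr1 mulrC.
Qed.

(** The factors are added one at a time: the weight times those already present is still
    nondecreasing, so [integrate_out_tilt] applies again, also at a repeated site. *)
Lemma integrate_out_boundary (delta : R) r s y : 0 < delta < 1 -> uniq s -> {subset r <= s} ->
  contrast delta gamma ^+ size r * integrate_out s pweight y
    <= integrate_out s (fun v => pweight v * \prod_(i <- r) expinv gamma (v i)) y.
Proof.
move=> d01 us; have [c0 _] := andP (contrast_itv gamma0 d01).
have ur q : unitmfun (fun v : 'I_N -> R => \prod_(i <- q) expinv gamma (v i)).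
  by apply: unitmfun_prod => i; apply: unitmfun_coord; exact: unitfun_expinv.
have up := unitmfun_pweight; have upr q := unitmfunM up (ur q).
elim: r => [|i r ih] rs.
  by rewrite expr0 mul1r; apply: le_integrate_out => [//|//|v]; rewrite big_nil mulr1.
rewrite /= exprS -mulrA.
apply: le_trans (ler_wpM2l (ltW c0) (ih _)) _.
  by move=> j jr; apply: rs; rewrite in_cons jr orbT.
apply: le_trans (integrate_out_tilt _ gamma0 d01 (upr r) _ us (rs i (mem_head _ _))) _.
  move=> u v uv; apply: ler_pM; rewrite ?pweight_ge0 ?nondecreasing_pweight//.
    by apply: (unitmfun_ge0 _ (ur r)).
  by apply: ler_prod => j _; rewrite expinv_ge0 le_expinv.
apply: le_integrate_out => // [|v]; last by rewrite big_cons -mulrA [X in _ * X]mulrC.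
by apply: unitmfunM => //; apply: unitmfun_coord; exact: unitfun_expinv.
Qed.

End circle_weight.

(** * Arcs of the circle *)

Section circle_geometry.
Variables (N : nat) (a : 'I_N).
Implicit Types (x : 'I_N) (h m p : nat).

(** The counter h is not reduced modulo N, so an arc that wraps around is still the image of an
    interval. *)
Definition site h : 'I_N := iter h (@ordS N) a.

Lemma site_val h : site h = ((a + h) %% N)%N :> nat.
Proof.
elim: h => [|h ih]; first by rewrite addn0 modn_small.
by rewrite /site iterS /= -/(site h) ih -addn1 modnDml addn1 addnS.
Qed.

Lemma siteD h m : iter m (@ordS N) (site h) = site (h + m).
Proof. by rewrite /site addnC iterD. Qed.

Lemma site_addN h : site (h + N) = site h.
Proof. by apply: val_inj; rewrite /= !site_val addnA modnDr. Qed.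

Lemma cdist_site h m : (m < N)%N -> cdist (site h) (site (h + m)) = m.
Proof.
move=> mN; rewrite /cdist !site_val addnA -(modnDml (a + h)).
have xN : ((a + h) %% N < N)%N by rewrite ltn_mod; lia.
rewrite modnDml; move: xN; set x := ((a + h) %% N)%N => xN.
by rewrite (_ : x + m + (N - x) = m + N)%N ?modnDr ?modn_small//; lia.
Qed.

Lemma site_neq h h' : (h < h' < h + N)%N -> site h != site h'.
Proof.
move=> hh'; apply/eqP => e; have mN : (h' - h < N)%N by lia.
have := cdist_site h mN; rewrite subnKC -?e; last by lia.
have N0 : (0 < N)%N by lia.
by have := cdist_site h N0; rewrite addn0 => -> ?; lia.
Qed.

Lemma site_surj x : exists2 h, (h < N)%N & x = site h.
Proof.
exists (cdist a x); first by rewrite ltn_mod; have := ltn_ord x; lia.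
apply: val_inj; rewrite /= site_val /cdist modnDmr addnCA subnKC; last by apply: ltnW.
by rewrite modnDr modn_small.
Qed.

Definition arc_sites m p : seq 'I_N := [seq site h | h <- iota m p].

Lemma arc_sites_uniq m p : (p <= N)%N -> uniq (arc_sites m p).
Proof.
move=> pN; rewrite map_inj_in_uniq ?iota_uniq// => h h'; rewrite !mem_iota => hm hm' e.
case: (ltngtP h h') => // hh'.
  by have := @site_neq h h'; rewrite e eqxx => /(_ _)/negP; rewrite hh'; case; lia.
by have := @site_neq h' h; rewrite e eqxx => /(_ _)/negP; rewrite hh'; case; lia.
Qed.

Lemma mem_arc_sites m p h : (p <= N)%N -> (m <= h < m + N)%N ->
  (site h \in arc_sites m p) = (h < m + p)%N.
Proof.
move=> pN hm; apply/idP/idP => [/mapP[h' + e]|hp]; last first.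
  by apply: map_f; rewrite mem_iota; lia.
rewrite mem_iota => h'm; case: (ltngtP h h') => hh'; [lia| |lia].
by have := @site_neq h' h; rewrite e eqxx => /(_ _)/negP; case; lia.
Qed.

Lemma perm_arc_sites_enum : perm_eq (arc_sites 0 N) (enum 'I_N).
Proof.
apply: uniq_perm; [exact: arc_sites_uniq|exact: enum_uniq|move=> x].
have [h hN ->] := site_surj x.
by rewrite mem_arc_sites// mem_enum.
Qed.

End circle_geometry.

(* [I] occupies the sites 0, ..., k and [J] the sites d, ..., d + l; the gap from
   [I] to [J] has p sites and the gap from [J] back to [I] has q. *)
Section two_arcs.
Variables (N : nat) (a : 'I_N) (k p l q : nat).
Hypothesis NE : N = (k + p + l + q).+2.
Let d := (k + p).+1.
Implicit Types I J : {set 'I_N}.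
Local Notation e := (site a).

Variables I J : {set 'I_N}.
Hypothesis IE : forall x, (x \in I) = (x \in arc_sites a 0 k.+1).
Hypothesis JE : forall x, (x \in J) = (x \in arc_sites a d l.+1).

Lemma site_in_I h : (h < N)%N -> (e h \in I) = (h <= k)%N.
Proof. by move=> hN; rewrite IE mem_arc_sites//; lia. Qed.

Lemma site_in_J h : (h < N)%N -> (e h \in J) = (d <= h <= d + l)%N.
Proof.
move=> hN; rewrite JE; case: (leqP d h) => dh /=; first by rewrite mem_arc_sites//; lia.
by rewrite -site_addN mem_arc_sites; lia.
Qed.

(** The boundary bonds of the arc can start only at its last site k and at site N - 1, just before
    site 0. *)
Lemma card_boundary : (#|boundary I| <= 2)%N.
Proof.
apply: (@leq_trans #|[set e k; e N.-1]%SET|); last by rewrite finset.cards2; case: eqP.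
apply: subset_leq_card; apply/fintype.subsetP => x; rewrite finset.in_set finset.in_set2.
have [h hN ->] := site_surj a x; rewrite site_in_I//.
have -> : ordS (e h) = e h.+1 by [].
have [h1|h1] := ltnP h.+1 N; last first.
  by move=> _; rewrite (_ : h = N.-1) ?eqxx ?orbT//; lia.
rewrite site_in_I//; case: (ltngtP h k) => [||->]; rewrite ?eqxx//; lia.
Qed.

(** A site beyond J meets site 0 of I before any site of J, so the gap lies strictly between k and
    the start of J. An upper bound suffices: the separation is only used as a lower bound for p and
    q. *)
Lemma gap_IJ_le : (#|gap I J| <= p)%N.
Proof.
rewrite -[leqRHS](size_iota k.+1 p) -(size_map e).
apply: (@leq_trans #|arc_sites a k.+1 p|); last exact: card_size.
apply: subset_leq_card; apply/fintype.subsetP => x.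
rewrite finset.in_set finset.in_setC finset.in_setU negb_or.
have [h hN ->] := site_surj a x; rewrite site_in_I// site_in_J//.
move=> /andP[/andP[hI hJ] /existsP[j /andP[jJ /forallP/(_ (e 0))]]].
rewrite site_in_I ?leq0n ?implyTb; last by lia.
rewrite mem_arc_sites; [|lia..].
have [//|hd] := ltnP h (k.+1 + p).
move: jJ; rewrite JE => /mapP[h']; rewrite mem_iota => h'd ->.
(* Seen from h, the sites of J come one turn later, at h' + N, while site 0 comes at N. *)
rewrite -(site_addN a 0) -(site_addN a h').
rewrite (_ : h' + N = h + (h' + N - h))%N ?cdist_site; [|lia..].
by rewrite (_ : 0 + N = h + (N - h))%N ?cdist_site; lia.
Qed.

Lemma gap_JI_le : (#|gap J I| <= q)%N.
Proof.
rewrite -[leqRHS](size_iota (d + l).+1 q) -(size_map e).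
apply: (@leq_trans #|arc_sites a (d + l).+1 q|); last exact: card_size.
apply: subset_leq_card; apply/fintype.subsetP => x.
rewrite finset.in_set finset.in_setC finset.in_setU negb_or.
have [h hN ->] := site_surj a x; rewrite site_in_I// site_in_J//.
move=> /andP[/andP[hJ hI] /existsP[i /andP[iI /forallP/(_ (e d))]]].
rewrite site_in_J; last by lia.
rewrite leqnn leq_addr implyTb.
have [hd|hd] := ltnP (d + l) h; first by move=> _; rewrite mem_arc_sites; lia.
move: iI; rewrite IE => /mapP[h']; rewrite mem_iota => h'k ->.
rewrite -(site_addN a h') (_ : h' + N = h + (h' + N - h))%N ?cdist_site; [|lia..].
by rewrite (_ : d = h + (d - h))%N ?cdist_site; lia.
Qed.

Lemma perm_enum_gaps :
  perm_eq (enum (~: (I :|: J))%SET) (arc_sites a k.+1 p ++ arc_sites a (d + l).+1 q).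
Proof.
apply: uniq_perm; first exact: enum_uniq.
  rewrite cat_uniq !arc_sites_uniq ?andbT/=; [|lia..].
  apply/hasPn => x /mapP[h]; rewrite mem_iota => hq ->.
  by rewrite mem_arc_sites; lia.
move=> x; rewrite mem_cat mem_enum finset.in_setC finset.in_setU.
have [h hN ->] := site_surj a x; rewrite site_in_I// site_in_J//.
have [hk|hk] := leqP h k.
  by rewrite -!(site_addN a h) !mem_arc_sites; lia.
have [hd|hd] := ltnP h (d + l).+1.
  by rewrite mem_arc_sites; [rewrite -(site_addN a h) mem_arc_sites; lia|lia..].
by rewrite !mem_arc_sites; lia.
Qed.

End two_arcs.

(** Sites are counted from the first site of I. Disjointness forces J to start after k, and to end
    before N because it would otherwise wrap around onto site 0. *)
Lemma two_arcs_of_consecutive N (I J : {set 'I_N}) :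
    I != finset.set0 -> J != finset.set0 -> [disjoint I & J] ->
    consecutive I -> consecutive J ->
  exists (a : 'I_N) (k p l q : nat), [/\ N = (k + p + l + q).+2,
    forall x, (x \in I) = (x \in arc_sites a 0 k.+1) &
    forall x, (x \in J) = (x \in arc_sites a (k + p).+1 l.+1)].
Proof.
move=> I0 J0 dIJ [a [k' IE]] [b [l' JE]].
have IE' x : (x \in I) = (x \in arc_sites a 0 k').
  rewrite IE; apply/imsetP/mapP => [[h _ ->]|[h + ->]].
    by exists (h : nat); rewrite ?mem_iota//= ltn_ord.
  by rewrite mem_iota => hk; exists (Ordinal hk).
have [d dN bE] := site_surj a b.
have JE' x : (x \in J) = (x \in arc_sites a d l').
  rewrite JE bE; apply/imsetP/mapP => [[h _ ->]|[h + ->]].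
    by exists (d + h)%N; rewrite ?siteD// mem_iota; have := ltn_ord h; lia.
  rewrite mem_iota => hk; have hl : (h - d < l')%N by lia.
  by exists (Ordinal hl) => //=; rewrite siteD; congr site; lia.
case: k' IE IE' => [|k] _ IE'.
  by case/set0Pn: I0 => x; rewrite IE'.
case: l' JE JE' => [|l] _ JE'.
  by case/set0Pn: J0 => x; rewrite JE'.
have kd : (k < d)%N.
  rewrite ltnNge; apply/negP => dk; have dI : site a d \in I.
    by rewrite IE'; apply: map_f; rewrite mem_iota; lia.
  by move: (disjointFr dIJ dI); rewrite JE' map_f// mem_iota; lia.
have dlN : (d + l < N)%N.
  rewrite ltnNge; apply/negP => Ndl; have aI : site a 0 \in I.
    by rewrite IE'; apply: map_f; rewrite mem_iota.
  by move: (disjointFr dIJ aI); rewrite JE' -(site_addN a 0) map_f// mem_iota; lia.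
exists a, k, (d - k.+1)%N, l, (N - (d + l).+1)%N; split=> // [|x]; first by lia.
by rewrite JE'; congr (_ \in arc_sites a _ _); lia.
Qed.

(** * Factorization of the weight along the circle *)

Section chains.
Variables (R : realType) (N : nat) (a : 'I_N) (b gamma : R).
Implicit Types (y v : 'I_N -> R).
Local Notation e := (site a).
Local Notation pw := (path_weight b gamma).

Definition core m k y : R :=
  (\prod_(m <= h < (m + k).+1) expinv b (y (e h))) * \prod_(m <= h < m + k) bond gamma y (e h).

(** The bond leaving site m, then p free sites, each with the bond leaving it. The site factors of
    the two ends belong to the adjacent cores. *)
Definition chain m p y : R :=
  bond gamma y (e m) *
  \prod_(m.+1 <= h < m.+1 + p) (expinv b (y (e h)) * bond gamma y (e h)).

Lemma chain0 m y : chain m 0 y = bond gamma y (e m).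
Proof. by rewrite /chain addn0 big_geq ?mulr1. Qed.

Lemma chainS m p y : chain m p.+1 y =
  bond gamma y (e m) * expinv b (y (e m.+1)) * chain m.+1 p y.
Proof.
rewrite /chain -[(m.+1 + p.+1)%N]addSnnS big_ltn; last by rewrite leq_addr.
by rewrite !mulrA.
Qed.

(** The circle is cut before the first site of each gap and of J; the last bond of each core block
    is handed to the chain that follows. *)
Lemma pweight_chain k p l q y : N = (k + p + l + q).+2 ->
  pweight b gamma y = core 0 k y * core (k + p).+1 l y *
    (chain k p y * chain ((k + p).+1 + l) q y).
Proof.
move=> NE.
have block m n : \prod_(m <= h < (m + n).+1) (expinv b (y (e h)) * bond gamma y (e h)) =
    core m n y * bond gamma y (e (m + n)).
  by rewrite big_split/= /core [X in _ * X]big_nat_recr ?leq_addr//= mulrA.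
rewrite /pweight -big_enum -(perm_big _ (perm_arc_sites_enum a))/= big_map.
rewrite -[N in iota 0 N]subn0 -/(index_iota 0 N).
rewrite (big_cat_nat (n := k.+1))//=; last by lia.
rewrite [X in _ * X](big_cat_nat (n := (k + p).+1))//=; [|lia..].
rewrite [X in _ * (_ * X)](big_cat_nat (n := ((k + p).+1 + l).+1))//=; [|lia..].
have := block 0%N k; rewrite add0n => ->; rewrite block /chain.
rewrite (_ : (((k + p).+1 + l).+1 + q)%N = N)// addSn; ring.
Qed.

Lemma core_ge0 m k y : 0 <= core m k y.
Proof.
rewrite /core mulr_ge0//; apply: prodr_ge0 => h _; exact: expinv_ge0.
Qed.

Lemma core_gt0P m k y h : core m k y != 0 -> (m <= h <= m + k)%N -> 0 < y (e h).
Proof.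
rewrite /core mulf_eq0 negb_or => /andP[+ _] hm.
rewrite prodf_seq_neq0 => /allP/(_ h); rewrite mem_index_iota ltnS => /(_ hm)/=.
by rewrite /expinv; case: ifP => //; rewrite eqxx.
Qed.

Lemma eq_core m k y v : (forall h, (m <= h <= m + k)%N -> y (e h) = v (e h)) ->
  core m k y = core m k v.
Proof.
move=> yv; rewrite /core; congr (_ * _); apply: eq_big_nat => h hm.
  by rewrite yv//; lia.
by rewrite /bond -[ordS _]/(e h.+1) !yv//; lia.
Qed.

Lemma eq_chain m p y v : (forall h, (m <= h <= m.+1 + p)%N -> y (e h) = v (e h)) ->
  chain m p y = chain m p v.
Proof.
move=> yv; rewrite /chain; congr (_ * _).
  by rewrite /bond -[ordS _]/(e m.+1) !yv//; lia.
apply: eq_big_nat => h hm.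
by rewrite /bond -[ordS _]/(e h.+1) !yv//; lia.
Qed.

Hypotheses (b0 : 0 <= b) (gamma0 : 0 <= gamma).

Lemma unitmfun_chain m p : unitmfun (chain m p).
Proof.
apply: unitmfunM; first exact: unitmfun_bond.
apply: unitmfun_prod => h; apply: unitmfunM; last exact: unitmfun_bond.
by apply: unitmfun_coord; exact: unitfun_expinv.
Qed.

Lemma upd_notin (s : seq 'I_N) y i h (t : R) : i \in s -> e h \notin s ->
  [eta y with i |-> t] (e h) = y (e h).
Proof. by move=> js hs /=; case: eqP => // hi; rewrite hi js in hs. Qed.

(** Each free site contributes one transfer step, starting with the site next to m; p < N keeps the
    ends out of the integrated sites. *)
Lemma integrate_out_chain m p y : (p < N)%N ->
  integrate_out (arc_sites a m.+1 p) (chain m p) y = pw p (y (e m)) (y (e (m.+1 + p))).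
Proof.
elim: p m y => [|p ih] m y pN; first by rewrite /= chain0 addn0.
rewrite -[arc_sites a m.+1 p.+1]/(e m.+1 :: arc_sites a m.+2 p) integrate_out_cons.
rewrite /path_weight iterS {1}/transfer; congr integral01; apply/funext => t.
have -> : chain m p.+1 =
    (fun v => bond gamma v (e m) * expinv b (v (e m.+1)) * chain m.+1 p v).
  by apply/funext => v; exact: chainS.
have mem h : (m.+2 <= h < m.+2 + N)%N -> (e h \in arc_sites a m.+2 p) = (h < m.+2 + p)%N.
  by move=> hm; rewrite mem_arc_sites//; lia.
have nm : e m \notin arc_sites a m.+2 p by rewrite -site_addN mem; lia.
have nm1 : e m.+1 \notin arc_sites a m.+2 p by rewrite -site_addN mem; lia.
rewrite integrate_outZ; last 2 first.
- exact: unitmfun_chain.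
- by move=> u i r im; rewrite /bond -[ordS _]/(e m.+1) !(upd_notin _ _ im).
rewrite ih; last by lia.
have updE h : e h != e m.+1 -> [eta y with e m.+1 |-> t] (e h) = y (e h).
  by move=> /negbTE /= ->.
have upd1 : [eta y with e m.+1 |-> t] (e m.+1) = t by rewrite /= eqxx.
rewrite /bond -[ordS _]/(e m.+1) upd1 updE; last by apply: site_neq; lia.
rewrite addSnnS updE; last by rewrite eq_sym; apply: site_neq; lia.
by rewrite [X in X * _]mulrC.
Qed.

End chains.

(** * Comparison of marginals *)

Section mixing.
Variables (R : realType) (N : nat) (b gamma : R).
Hypotheses (b0 : 0 <= b) (gamma0 : 0 <= gamma).
Variables (a : 'I_N) (k p l q : nat).
Hypothesis NE : N = (k + p + l + q).+2.
Variables I J : {set 'I_N}.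
Hypothesis IE : forall x, (x \in I) = (x \in arc_sites a 0 k.+1).
Hypothesis JE : forall x, (x \in J) = (x \in arc_sites a (k + p).+1 l.+1).
Implicit Types (y v : 'I_N -> R).
Local Notation d := (k + p).+1.
Local Notation e := (site a).
Local Notation pw := (path_weight b gamma).
Local Notation w := (pweight b gamma).
Local Notation unnorm S := (integrate_out (enum (~: S)%SET) w).
Local Notation F := (unnorm (I :|: J)).
Local Notation total := (integrate_out (enum 'I_N) w).

Let uw : unitmfun w := unitmfun_pweight N b0 gamma0.

Let disjIJ : [disjoint I & J].
Proof.
apply/pred0P => x /=; apply/negP => /andP[]; have [h hN ->] := site_surj a x.
by rewrite (site_in_I NE IE)// (site_in_J NE JE)//; lia.
Qed.

Lemma unnormIJ_factor y :
  F y = core a b gamma 0 k y * core a b gamma d l y *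
    (pw p (y (e k)) (y (e d)) * pw q (y (e (d + l))) (y (e 0))).
Proof.
rewrite (perm_integrate_out _ uw (perm_enum_gaps NE IE JE)) integrate_out_cat.
have uc m n : unitmfun (chain a b gamma m n) by exact: unitmfun_chain.
have out1 h : (k.+1 + p <= h <= k + N)%N -> e h \notin arc_sites a k.+1 p.
  by move=> hh; rewrite mem_arc_sites; lia.
have out2 h : ((d + l).+1 + q <= h <= d + l + N)%N -> e h \notin arc_sites a (d + l).+1 q.
  by move=> hh; rewrite mem_arc_sites; lia.
(* The gap from J back to I is integrated first; among the factors, only its own chain involves its
   sites. *)
have inner : integrate_out (arc_sites a (d + l).+1 q) w =
    (fun v => (core a b gamma 0 k v * core a b gamma d l v *
      pw q (v (e (d + l))) (v (e 0))) * chain a b gamma k p v).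
  apply/funext => v.
  have -> : w = (fun v => (core a b gamma 0 k v * core a b gamma d l v *
      chain a b gamma k p v) * chain a b gamma (d + l) q v).
    by apply/funext => u; rewrite (pweight_chain a b gamma u NE) !mulrA.
  rewrite integrate_outZ//; last first.
    move=> u i t ii.
    have ue h : (h <= d + l)%N -> [eta u with i |-> t] (e h) = u (e h).
      by move=> hh; apply: (upd_notin _ _ ii); rewrite -site_addN out2//; lia.
    congr (_ * _ * _).
    - by apply: eq_core => h hh; apply: ue; lia.
    - by apply: eq_core => h hh; apply: ue; lia.
    - by apply: eq_chain => h hh; apply: ue; lia.
  rewrite integrate_out_chain//; last by lia.
  (* The far end of this gap is site N, that is, site 0. *)
  rewrite (_ : ((d + l).+1 + q = 0 + N)%N) ?site_addN; last by lia.
  by rewrite mulrAC.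
rewrite inner integrate_outZ//; last first.
  move=> u i t ii.
  have ue h : (h <= k)%N -> [eta u with i |-> t] (e h) = u (e h).
    by move=> hh; apply: (upd_notin _ _ ii); rewrite -site_addN out1//; lia.
  have ue' h : (d <= h <= d + l)%N -> [eta u with i |-> t] (e h) = u (e h).
    by move=> hh; apply: (upd_notin _ _ ii); rewrite out1//; lia.
  congr (_ * _ * _).
  - by apply: eq_core => h hh; apply: ue; lia.
  - by apply: eq_core => h hh; apply: ue'; lia.
  - by rewrite ue'// ?ue//; lia.
rewrite integrate_out_chain//; last by lia.
by rewrite -[LHS]mulrA [X in _ * X]mulrC.
Qed.

(** Both marginals arise from [F], the first by integrating J out and the second by integrating I
    out. *)
Lemma unnorm_two_copies y : unnorm I y * unnorm J y =
  integrate_out (enum I ++ enum J) (fun v => F (mix J v y) * F (mix I v y)) y.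
Proof.
have uF := unitmfun_integrate_out (enum (~: (I :|: J))%SET) uw.
rewrite integrate_out_two_copies//; congr (_ * _); rewrite -integrate_out_cat;
  apply/esym/perm_integrate_out => //; apply: perm_enum_cat => [|i].
- by apply/pred0P => i /=; rewrite !inE; case: (i \in J); rewrite ?orbT.
- have := disjIJ => /pred0P/(_ i)/=; rewrite !inE.
  by case: (i \in I); case: (i \in J).
- by apply/pred0P => i /=; rewrite !inE; case: (i \in I).
- have := disjIJ => /pred0P/(_ i)/=; rewrite !inE.
  by case: (i \in I); case: (i \in J).
Qed.

Lemma total_two_copies y : F y * total y =
  integrate_out (enum I ++ enum J) (fun v => F y * F v) y.
Proof.
have uF := unitmfun_integrate_out (enum (~: (I :|: J))%SET) uw.
rewrite integrate_outZ_cst//; congr (_ * _); rewrite -integrate_out_cat.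
apply/esym/perm_integrate_out => //.
apply: (@perm_trans _ (enum (I :|: J)%SET ++ enum (~: (I :|: J))%SET)).
  by rewrite perm_cat2r; apply: perm_enum_cat => // i; rewrite !inE.
apply: perm_enum_cat => [|i]; last by rewrite !inE; case: (i \in I); case: (i \in J).
by apply/pred0P => i /=; rewrite !inE; case: (i \in I); case: (i \in J).
Qed.

Variable delta : R.
Hypothesis delta01 : 0 < delta < 1.
Local Notation th := (theta gamma delta).
Local Notation err := (gap_error gamma delta).

Lemma unnorm_boundary y :
  th ^+ 4 * (F y * total y) <= unnorm I y * unnorm J y.
Proof.
have uF := unitmfun_integrate_out (enum (~: (I :|: J))%SET) uw.
have -> : unnorm I y * unnorm J y = integrate_out (enum I ++ enum (~: I)%SET)
    (fun v => w (mix (~: I)%SET v y) * F (mix I v y)) y.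
  rewrite integrate_out_two_copies//; last by apply/pred0P => i /=; rewrite !inE; case: (i \in I).
  congr (_ * _); rewrite -integrate_out_cat; apply/esym/perm_integrate_out => //.
  apply: perm_enum_cat => [|i].
    by apply/pred0P => i /=; rewrite !inE; case: (i \in I).
  have := disjIJ => /pred0P/(_ i)/=; rewrite !inE.
  by case: (i \in I); case: (i \in J).
have pI : perm_eq (enum I ++ enum (~: I)%SET) (enum 'I_N).
  apply: perm_enum_cat => [|i]; last by rewrite !inE; case: (i \in I).
  by apply/pred0P => i /=; rewrite !inE; case: (i \in I).
have uE : unitmfun (fun v : 'I_N -> R => \prod_(i <- boundary_sites I) expinv gamma (v i)).
  by apply: unitmfun_prod => i; apply: unitmfun_coord; exact: unitfun_expinv.
have uG : unitmfun (fun v => w (mix (~: I)%SET v y) * F (mix I v y)).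
  by apply: unitmfunM; exact: unitmfun_mix.
rewrite (perm_integrate_out _ uG pI).
(* This is [swap_pweight] integrated over the gap coordinates u of the first copy:
   [w (mix (~: I) v u)] does not depend on them, and the other exchanged weight integrates to
   [F (mix I v y)]. *)
have swap v : F y * (w v * \prod_(i <- boundary_sites I) expinv gamma (v i))
    <= w (mix (~: I)%SET v y) * F (mix I v y).
  have outI i : i \in enum (~: (I :|: J))%SET -> i \notin I.
    by rewrite mem_enum !inE negb_or => /andP[].
  have mixC u : mix I v u = mix (~: I)%SET u v.
    by apply/funext => i; rewrite /mix !inE; case: (i \in I).
  have -> : F (mix I v y) = integrate_out (enum (~: (I :|: J))%SET) (fun u => w (mix I v u)) y.
    have -> : (fun u => w (mix I v u)) = (fun u => w (mix (~: I)%SET u v)).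
      by apply/funext => u; rewrite mixC.
    by rewrite integrate_out_mix ?mixC// => i /outI; rewrite inE.
  have umI : unitmfun (fun u => w (mix I v u)).
    by under eq_fun do rewrite mixC; exact: unitmfun_mix.
  have <- : integrate_out (enum (~: (I :|: J))%SET)
      (fun u => w (mix (~: I)%SET v u) * w (mix I v u)) y =
      w (mix (~: I)%SET v y) *
      integrate_out (enum (~: (I :|: J))%SET) (fun u => w (mix I v u)) y.
    apply: (integrate_outZ (c := fun u => w (mix (~: I)%SET v u))) => //.
    move=> u i t /outI iI; congr w; apply/funext => h; rewrite /mix !inE/=.
    by case: (boolP (h \in I)) => //= hI; case: eqP => // hi; rewrite -hi hI in iI.
  rewrite mulrC -integrate_outZ_cst//.
  have mixC' u : mix (~: I)%SET v u = mix I u v.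
    by apply/funext => i; rewrite /mix !inE; case: (i \in I).
  apply: le_integrate_out => [||u].
  - by apply: (unitmfunM _ uw); apply: unitmfun_cst; case: (unitmfunM uw uE) => _; exact.
  - by apply: unitmfunM => //; under eq_fun do rewrite mixC'; exact: unitmfun_mix.
  - by rewrite mulrC mulrA; exact: swap_pweight.
apply: (@le_trans _ _ (F y * integrate_out (enum 'I_N)
    (fun v => w v * \prod_(i <- boundary_sites I) expinv gamma (v i)) y)); last first.
  rewrite -integrate_outZ_cst; last exact: unitmfunM.
  apply: le_integrate_out => //.
  apply: (unitmfunM _ (unitmfunM uw uE)); apply: unitmfun_cst.
  by case: uF => _; exact.
rewrite mulrCA ler_wpM2l//; first exact: unitmfun_ge0.
have sub : {subset boundary_sites I <= enum 'I_N} by move=> i _; rewrite mem_enum.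
apply: le_trans (integrate_out_boundary b0 gamma0 y delta01 (enum_uniq 'I_N) sub).
rewrite ler_wpM2r//.
  by apply: (unitmfun_ge0 y); exact: unitmfun_integrate_out.
have /andP[c0 c1] := contrast_itv gamma0 delta01.
have /andP[th0 th1] := theta_itv gamma0 delta01.
(* At most two boundary bonds have two ends each, and each end costs [contrast delta gamma], which
   is at least [theta]; hence the power 4. *)
have thc : th <= contrast delta gamma.
  case/andP: delta01 => d0 d1; rewrite /theta /contrast ler_wpM2l ?subr_ge0 ?(ltW d1)//.
  by rewrite ler_expR lerN2 ler_wpM2r ?invr_ge0 ?(ltW d0)// lerDl.
have size4 : (size (boundary_sites I) <= 4)%N.
  by rewrite /boundary_sites size_cat size_map -!cardE addnn (leq_double _ 2)
    (card_boundary NE IE).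
apply: (@le_trans _ _ (contrast delta gamma ^+ 4)).
  by rewrite lerXn2r// nnegrE ltW.
by rewrite ler_wiXn2l// ltW.
Qed.

(** The cores contribute the same product to both sides. What remains is one cross ratio per gap,
    each costing a factor 1 + err; the second inequality exchanges the starting points of the two
    copies. *)
Lemma cross_IJ j y v : (j.+1.*2 <= p)%N -> (j.+1.*2 <= q)%N ->
  F y * F v <= (1 + err j) ^+ 2 * (F (mix J v y) * F (mix I v y)) /\
  F (mix J v y) * F (mix I v y) <= (1 + err j) ^+ 2 * (F y * F v).
Proof.
move=> jp jq; rewrite !unnormIJ_factor.
have k_in : (0 <= k <= 0 + k)%N by rewrite leqnn.
have d_in : (d <= d <= d + l)%N by rewrite leqnn leq_addr.
have dl_in : (d <= d + l <= d + l)%N by rewrite leqnn leq_addr.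
have mI (u u' : 'I_N -> R) h : (h <= k)%N -> mix I u u' (e h) = u (e h).
  by move=> hk; rewrite /mix (site_in_I NE IE) ?hk//; lia.
have mJ (u u' : 'I_N -> R) h : (d <= h <= d + l)%N -> mix J u u' (e h) = u (e h).
  by move=> hk; rewrite /mix (site_in_J NE JE) ?hk//; lia.
have mI' (u u' : 'I_N -> R) h : (d <= h <= d + l)%N -> mix I u u' (e h) = u' (e h).
  move=> hk; rewrite /mix (site_in_I NE IE); last by lia.
  by have -> : (h <= k)%N = false by lia.
have mJ' (u u' : 'I_N -> R) h : (h <= k)%N -> mix J u u' (e h) = u' (e h).
  move=> hk; rewrite /mix (site_in_J NE JE); last by lia.
  by have -> : (d <= h <= d + l)%N = false by lia.
have -> : core a b gamma 0 k (mix J v y) = core a b gamma 0 k y.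
  by apply: eq_core => h hh; apply: mJ'; lia.
have -> : core a b gamma 0 k (mix I v y) = core a b gamma 0 k v.
  by apply: eq_core => h hh; apply: mI; lia.
have -> : core a b gamma d l (mix J v y) = core a b gamma d l v.
  by apply: eq_core => h hh; apply: mJ; lia.
have -> : core a b gamma d l (mix I v y) = core a b gamma d l y.
  by apply: eq_core => h hh; apply: mI'; lia.
rewrite (mI v y k) ?(mI v y 0%N) ?(mI' v y d) ?(mI' v y (d + l)%N); [|lia..].
rewrite (mJ' v y k) ?(mJ' v y 0%N) ?(mJ v y d) ?(mJ v y (d + l)%N); [|lia..].
have c0 := core_ge0 a b gamma.
have pw0 n x z : 0 <= pw n x z.
  by rewrite /path_weight; apply: unitfun_ge0; apply: unitfun_iter_transfer => //;
    exact: unitfun_kernelC.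
(* If a core vanishes, both sides are 0; otherwise all ends of the gaps are positive, as
   [path_weight_cross] requires. *)
have [A0|] := eqVneq (core a b gamma 0 k y) 0; first by rewrite A0 !(mul0r, mulr0).
have [A0|] := eqVneq (core a b gamma 0 k v) 0; first by rewrite A0 !(mul0r, mulr0).
have [A0|] := eqVneq (core a b gamma d l y) 0; first by rewrite A0 !(mul0r, mulr0).
have [A0|] := eqVneq (core a b gamma d l v) 0; first by rewrite A0 !(mul0r, mulr0).
move=> Jv Jy Iv Iy.
have [y1 y2] : 0 < y (e k) /\ 0 < y (e 0).
  by split; [exact: (core_gt0P Iy k_in)|exact: (core_gt0P Iy)].
have [v1 v2] : 0 < v (e k) /\ 0 < v (e 0).
  by split; [exact: (core_gt0P Iv k_in)|exact: (core_gt0P Iv)].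
have [y3 y4] : 0 < y (e d) /\ 0 < y (e (d + l)).
  by split; [exact: (core_gt0P Jy d_in)|exact: (core_gt0P Jy dl_in)].
have [v3 v4] : 0 < v (e d) /\ 0 < v (e (d + l)).
  by split; [exact: (core_gt0P Jv d_in)|exact: (core_gt0P Jv dl_in)].
have P1 := path_weight_cross b0 gamma0 delta01 jp y1 v1 y3 v3.
have P2 := path_weight_cross b0 gamma0 delta01 jp v1 y1 y3 v3.
have Q1 := path_weight_cross b0 gamma0 delta01 jq y4 v4 y2 v2.
have Q2 := path_weight_cross b0 gamma0 delta01 jq v4 y4 y2 v2.
have e0 := gap_error_ge0 gamma0 delta01 j.
set c := core a b gamma 0 k y * core a b gamma 0 k v *
  core a b gamma d l y * core a b gamma d l v.
have cc0 : 0 <= c by rewrite /c; do 3 (apply: mulr_ge0; last exact: c0); exact: c0.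
split.
  rewrite [leLHS](_ : _ = c * ((pw p (y (e k)) (y (e d)) * pw p (v (e k)) (v (e d))) *
    (pw q (y (e (d + l))) (y (e 0)) * pw q (v (e (d + l))) (v (e 0))))); last by rewrite /c; ring.
  rewrite [leRHS](_ : _ = c * (((1 + err j) * (pw p (v (e k)) (y (e d)) *
      pw p (y (e k)) (v (e d)))) *
    ((1 + err j) * (pw q (v (e (d + l))) (y (e 0)) * pw q (y (e (d + l))) (v (e 0)))))); last first.
    by rewrite /c; ring.
  rewrite ler_wpM2l//; apply: ler_pM; [exact: mulr_ge0|exact: mulr_ge0|exact: P1|exact: Q1].
rewrite [leRHS](_ : _ = c * (((1 + err j) * (pw p (y (e k)) (y (e d)) *
      pw p (v (e k)) (v (e d)))) *
    ((1 + err j) * (pw q (y (e (d + l))) (y (e 0)) * pw q (v (e (d + l))) (v (e 0)))))); last first.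
  by rewrite /c; ring.
rewrite [leLHS](_ : _ = c * ((pw p (v (e k)) (y (e d)) * pw p (y (e k)) (v (e d))) *
    (pw q (v (e (d + l))) (y (e 0)) * pw q (y (e (d + l))) (v (e 0))))); last first.
  by rewrite /c; ring.
rewrite ler_wpM2l//; apply: ler_pM; [exact: mulr_ge0|exact: mulr_ge0|exact: P2|exact: Q2].
Qed.

End mixing.

(** * Reduction to the unnormalized weight *)

Section normalization.
Variables (R : realType) (N : nat) (beta gamma : R).
Hypotheses (beta0 : 0 <= beta) (gamma0 : 0 <= gamma).
Implicit Types (y : 'I_N -> R) (S : {set 'I_N}).

Lemma weightE : @weight R N beta gamma = pweight (beta / 2) gamma.
Proof.
apply/funext => y; rewrite /weight; case: ifP => [/forallP yp|/negbT]; last first.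
  rewrite negb_forall => /existsP[i iy].
  by rewrite /pweight (bigD1 i)//= /expinv (negbTE iy) !mul0r.
rewrite -sumrN expR_sum; apply: eq_bigr => i _.
rewrite /bond /expinv yp addr_gt0// opprD expRD; congr (expR (- _) * _).
by rewrite invfM mulrA.
Qed.

Lemma partition_functionE y :
  partition_function N beta gamma = integrate_out (enum 'I_N) (pweight (beta / 2) gamma) y.
Proof.
rewrite /partition_function weightE; apply: integrate_out_congr => i.
by rewrite mem_enum.
Qed.

Lemma marginalE S y : marginal beta gamma S y =
  integrate_out (enum (~: S)%SET) (pweight (beta / 2) gamma) y / partition_function N beta gamma.
Proof.
rewrite /marginal /density weightE [RHS]mulrC -integrate_outZ_cst; last first.
  by apply: unitmfun_pweight; rewrite ?divr_ge0.
by apply: eq_integrate_out => v; rewrite mulrC.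
Qed.

End normalization.

(** * The decay rate as a function of gamma *)

Section rates.
Variable R : realType.
Implicit Types (rho gamma : R).

(* Both [1 - delta] and [exp (- 2 gamma / delta)] tend to 1 with [gamma] when
   [delta] is of order [sqrt gamma]; at [gamma = 0] any [delta] in ]0, 1[ works. *)
Definition cutoff_level gamma : R :=
  if gamma == 0 then 2^-1 else Num.sqrt gamma / (1 + Num.sqrt gamma).

Lemma cutoff_level_itv gamma : 0 <= gamma -> 0 < cutoff_level gamma < 1.
Proof.
move=> g0; rewrite /cutoff_level; have [_|gn0] := eqVneq gamma 0.
  by rewrite invr_gt0 ltr0n/= invf_lt1// ltr1n.
have s0 : 0 < Num.sqrt gamma by rewrite sqrtr_gt0 lt_neqAle eq_sym gn0.
have s1 : 0 < 1 + Num.sqrt gamma by rewrite addr_gt0.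
by rewrite divr_gt0//= ltr_pdivrMr// mul1r ltrDr.
Qed.

Definition contraction gamma : R := 1 - theta gamma (cutoff_level gamma).

Lemma contraction_itv gamma : 0 <= gamma -> 0 < contraction gamma < 1.
Proof.
move=> g0; have /andP[t0 t1] := theta_itv g0 (cutoff_level_itv g0).
by rewrite /contraction subr_gt0 t1 gtrBl.
Qed.

(** Two transfer steps, hence two sites of the gap, are spent on each factor [contraction gamma]. *)
Definition decay_rate gamma : R := - ln (contraction gamma) / 2.

(** The factor 3 theta^-4 covers both the bound for short gaps and (1 + err)^2 - 1; the power -2
    pays for an exponent j that falls short of r / 2 by at most 2. *)
Definition decay_const gamma : R :=
  3 * theta gamma (cutoff_level gamma) ^- 4 * contraction gamma ^- 2.

Lemma decay_rate_gt0 gamma : 0 <= gamma -> 0 < decay_rate gamma.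
Proof.
move=> g0; have /andP[r0 r1] := contraction_itv g0.
by rewrite /decay_rate divr_gt0// oppr_gt0 ln_lt0// r0.
Qed.

Lemma decay_const_gt0 gamma : 0 <= gamma -> 0 < decay_const gamma.
Proof.
move=> g0; have /andP[r0 r1] := contraction_itv g0.
have /andP[t0 t1] := theta_itv g0 (cutoff_level_itv g0).
by rewrite /decay_const !mulr_gt0// invr_gt0 exprn_gt0.
Qed.

Lemma contractionX_le gamma j r : 0 <= gamma -> (r <= j.+2.*2)%N ->
  contraction gamma ^+ j <= contraction gamma ^- 2 * expR (- decay_rate gamma * r%:R).
Proof.
move=> g0 rj; have /andP[r0 r1] := contraction_itv g0.
rewrite /decay_rate; set L := ln _.
have LE : contraction gamma = expR L by rewrite lnK.
have L0 : L < 0 by rewrite ln_lt0// r0.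
rewrite LE -!expRM_natl -expRN -expRD ler_expR.
have : r%:R <= j.+2.*2%:R :> R by rewrite ler_nat.
rewrite -muln2 natrM -addn2 natrD => rj'.
nra.
Qed.

(** With s = sqrt gamma, the factor 1 - delta is at least 1 - s and the exponential at least 1 - 2 s
    (1 + s) >= 1 - 4 s; the losses add up to 5 s. *)
Lemma contraction_le gamma : 0 < gamma -> gamma <= 1 ->
  contraction gamma <= 5 * Num.sqrt gamma.
Proof.
move=> g0 g1; set s := Num.sqrt gamma.
have s0 : 0 < s by rewrite sqrtr_gt0.
have s1 : s <= 1 by rewrite -sqrtr1 ler_sqrt.
have gE : gamma = s ^+ 2 by rewrite sqr_sqrtr// ltW.
rewrite /contraction /theta /contrast /cutoff_level gt_eqF// -/s.
have e1 := expR_ge1Dx (- ((gamma + gamma) / (s / (1 + s)))).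
have e2 : (gamma + gamma) / (s / (1 + s)) = 2 * s * (1 + s).
  by rewrite gE; field; rewrite !gt_eqF// addr_gt0.
rewrite e2 in e1 *.
have d1 : 1 - s / (1 + s) >= 1 - s.
  by rewrite lerD2l lerN2 ler_pdivrMr ?addr_gt0// mulrDr mulr1 lerDl mulr_ge0 ?ltW.
have d2 : 1 - s / (1 + s) <= 1 by rewrite gerBl divr_ge0 ?ltW// addr_gt0.
have e3 := expR_gt0 (- (2 * s * (1 + s))).
move: e1 e3 d1 d2; set E := expR _; set D := 1 - s / (1 + s) => e1 e3 d1 d2.
have e5 : E <= 1 by rewrite -expR0 ler_expR; nra.
nra.
Qed.

Lemma decay_rate_cvg : (decay_rate gamma @[gamma --> 0^'+] --> +oo)%classic.
Proof.
apply/cvgryPgt => A; near=> g.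
have g0 : 0 < g by near: g; exact: nbhs_right_gt.
have g1 : g <= 1 by near: g; apply: nbhs_right_le.
(* Chosen so that 5 sqrt g < exp (- 2 A), which makes the decay rate exceed A. *)
have gA : g < (expR (- (2 * A)) / 5) ^+ 2.
  by near: g; apply: nbhs_right_lt; rewrite exprn_gt0// divr_gt0// expR_gt0.
have /andP[r0 _] := contraction_itv (ltW g0).
rewrite /decay_rate ltr_pdivlMr// ltrNr -ltr_expR lnK//.
apply: le_lt_trans (contraction_le g0 g1) _.
rewrite mulrC -ltr_pdivlMr// [A * 2]mulrC.
rewrite -(ltr_pXn2r (n := 2)) ?nnegrE ?sqrtr_ge0 ?divr_ge0 ?expR_ge0//.
by rewrite sqr_sqrtr// ltW.
Unshelve. all: by end_near. Qed.

End rates.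

(** The lower side uses 1 - 1 / c <= c - 1. *)
Lemma two_sided_ratio (R : realFieldType) (A B c : R) :
  1 <= c -> 0 <= B -> A <= c * B -> B <= c * A -> `|A - B| <= (c - 1) * B.
Proof.
move=> c1 B0 AB BA; rewrite ler_norml; apply/andP; split; last by lra.
rewrite lerNl opprB -(ler_pM2l (lt_le_trans ltr01 c1)).
by have := mulr_ge0 (sqr_ge0 (c - 1)) B0; nra.
Qed.

(** * The mixing bound for unnormalized marginals *)

Section mixing_bound.
Variables (R : realType) (N : nat) (b gamma : R).
Hypotheses (b0 : 0 <= b) (gamma0 : 0 <= gamma).
Variables I J : {set 'I_N}.
Hypotheses (I0 : I != finset.set0) (J0 : J != finset.set0) (dIJ : [disjoint I & J]).
Hypotheses (cI : consecutive I) (cJ : consecutive J).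
Local Notation w := (pweight b gamma).
Local Notation unnorm S := (integrate_out (enum (~: S)%SET) w).
Local Notation total := (integrate_out (enum 'I_N) w).

Lemma unnorm_mixing y :
  `|unnorm (I :|: J) y * total y - unnorm I y * unnorm J y|
    <= decay_const gamma * expR (- decay_rate gamma * (separation I J)%:R)
         * (unnorm I y * unnorm J y).
Proof.
have [a [k [p [l [q [NE IE JE]]]]]] := two_arcs_of_consecutive I0 J0 dIJ cI cJ.
have rp := gap_IJ_le NE IE JE; have rq := gap_JI_le NE IE JE.
set r := separation I J.
have rpq : (r <= p)%N /\ (r <= q)%N.
  by rewrite /r /separation; split; lia.
(* The largest j with 2 (j + 1) <= r when r >= 2; truncated predecessor gives 0 when r <= 1. *)
pose j := r./2.-1.
have r_j : (r <= j.+2.*2)%N by rewrite /j; lia.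
have j0 : (r <= 1)%N -> j = 0%N by rewrite /j; lia.
have j_pq : (1 < r)%N -> (j.+1.*2 <= p)%N /\ (j.+1.*2 <= q)%N by rewrite /j; lia.
have d01 := cutoff_level_itv gamma0.
have uw := unitmfun_pweight N b0 gamma0.
have un (S : {set 'I_N}) : unitmfun (unnorm S) by exact: (unitmfun_integrate_out _ uw).
have bd := unnorm_boundary b0 gamma0 NE IE JE d01 y.
have cross := cross_IJ b0 gamma0 NE IE JE d01.
have tc := total_two_copies b0 gamma0 NE IE JE y.
have uc := unnorm_two_copies b0 gamma0 NE IE JE y.
have /andP[t0 t1] := theta_itv gamma0 d01.
have /andP[c0 c1] := contraction_itv gamma0.
set F := unnorm (I :|: J) in tc uc cross bd *.
set A := F y * total y in tc bd *; set B := unnorm I y * unnorm J y in uc bd *.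
have B0 : 0 <= B by rewrite mulr_ge0 ?unitmfun_ge0.
have A0 : 0 <= A by rewrite mulr_ge0 ?unitmfun_ge0//; exact: (unitmfun_integrate_out _ uw).
have decay : contraction gamma ^+ j <=
    contraction gamma ^- 2 * expR (- decay_rate gamma * r%:R).
  exact: contractionX_le.
set th := theta gamma (cutoff_level gamma) in t0 t1 bd cross.
suff main : `|A - B| <= 3 * th ^- 4 * contraction gamma ^+ j * B.
  apply: le_trans main _; rewrite ler_wpM2r// /decay_const -/th -[leRHS]mulrA ler_wpM2l//.
  by rewrite mulr_ge0// invr_ge0 exprn_ge0// ltW.
have th4 : 1 <= th ^- 4 by rewrite invf_ge1 ?exprn_gt0// exprn_ile1// ltW.
(* For separation at most 1 there are no two steps to contract with; A and B both lie between 0 and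
   th^-4 * B. *)
have [r1|r2] := leqP r 1.
  rewrite (j0 r1) expr0 mulr1.
  have AB : A <= th ^- 4 * B by rewrite -ler_pdivrMl ?invr_gt0 ?exprn_gt0// invrK.
  have TB : B <= th ^- 4 * B by rewrite ler_peMl.
  rewrite ler_norml -mulrA; move: AB TB; set X := th ^- 4 * B; lra.
have [jp jq] := j_pq r2.
set ep := gap_error gamma (cutoff_level gamma) j in cross.
have epE : ep = th ^- 2 * contraction gamma ^+ j by [].
have rj0 : 0 <= contraction gamma ^+ j by rewrite exprn_ge0 ?ltW.
have rj1 : contraction gamma ^+ j <= 1 by rewrite exprn_ile1 ?ltW.
have ep0 : 0 <= ep by rewrite epE mulr_ge0// invr_ge0 exprn_ge0// ltW.
pose c := (1 + ep) ^+ 2.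
have cgt0 : 0 < c by rewrite exprn_gt0// ltr_wpDr.
(* Dividing by c instead of multiplying keeps the integrands in [0, 1], as the comparison of
   iterated integrals demands. *)
have cinv : 0 <= c^-1 <= 1.
  by rewrite invr_ge0 (ltW cgt0) invf_le1// exprn_ege1// lerDl.
have uFF : unitmfun (fun v => F y * F v).
  by apply: (unitmfunM _ (un _)); exact: (@unitmfun_cst R N _ ((un _).2 y)).
have uFm : unitmfun (fun v => F (mix J v y) * F (mix I v y)).
  by apply: unitmfunM; exact: (unitmfun_mix _ _ (un _)).
have AB : A <= c * B.
  rewrite -ler_pdivrMl// tc uc -integrate_outZ_cst//.
  apply: le_integrate_out => // [|v]; first exact: unitmfunM (unitmfun_cst N cinv) uFF.
  by rewrite ler_pdivrMl//; case: (cross j y v jp jq).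
have BA : B <= c * A.
  rewrite -ler_pdivrMl// tc uc -integrate_outZ_cst//.
  apply: le_integrate_out => // [|v]; first exact: unitmfunM (unitmfun_cst N cinv) uFm.
  by rewrite ler_pdivrMl//; case: (cross j y v jp jq).
(* Here c - 1 = 2 ep + ep^2, and ep and ep^2 are both at most th^-4 times the power of the
   contraction; this is the origin of the 3. *)
have cle : c - 1 <= 3 * th ^- 4 * contraction gamma ^+ j.
  have e1 : ep <= th ^- 4 * contraction gamma ^+ j.
    rewrite epE ler_wpM2r// lef_pV2 ?posrE ?exprn_gt0//.
    by rewrite ler_wiXn2l// ltW.
  have e2 : ep ^+ 2 <= th ^- 4 * contraction gamma ^+ j.
    rewrite epE exprMn -exprVn -!exprM exprVn ler_wpM2l ?invr_ge0 ?exprn_ge0 ?(ltW t0)//.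
    by rewrite ler_wiXn2l ?(ltW c0) ?(ltW c1)// leq_pmulr.
  rewrite /c -mulrA; move: e1 e2; set X := th ^- 4 * _; lra.
apply: le_trans (_ : _ <= (c - 1) * B) _; last exact: ler_wpM2r.
by apply: two_sided_ratio => //; rewrite exprn_ege1// lerDl.
Qed.

End mixing_bound.

Theorem theorem2p1 (R : realType) :
  exists (C : R -> R -> R) (alpha : R -> R),
    [/\ (forall beta gamma : R, 0 < beta -> 0 <= gamma -> 0 < C beta gamma),
        (forall gamma : R, 0 <= gamma -> 0 < alpha gamma),
        (forall (beta gamma : R) (N : nat) (I J : {set 'I_N}) (y : 'I_N -> R),
           0 < beta -> 0 <= gamma ->
           I != finset.set0 -> J != finset.set0 -> [disjoint I & J] ->
           consecutive I -> consecutive J ->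
           (forall i, i \in I :|: J -> 0 <= y i <= 1) ->
           0 < marginal beta gamma J y ->
           `|conditional beta gamma I J y - marginal beta gamma I y|
             <= C beta gamma * expR (- alpha gamma * (separation I J)%:R)
                  * marginal beta gamma I y)
      & (alpha gamma @[gamma --> 0^'+] --> +oo)%classic].
Proof.
exists (fun _ gamma => decay_const gamma), (@decay_rate R); split.
- by move=> _ gamma _; exact: decay_const_gt0.
- exact: decay_rate_gt0.
- move=> beta gamma N I J y beta0 gamma0 I0 J0 dIJ cI cJ _ mJ.
  have b0 : 0 <= beta / 2 by rewrite divr_ge0 ?ltW.
  have := unnorm_mixing b0 gamma0 I0 J0 dIJ cI cJ y.
  have uw := unitmfun_pweight N b0 gamma0.
  move: mJ; rewrite /conditional !(marginalE (ltW beta0) gamma0).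
  rewrite (partition_functionE beta gamma y).
  have : 0 <= integrate_out (enum 'I_N) (pweight (beta / 2) gamma) y.
    by apply: (unitmfun_ge0 y); exact: unitmfun_integrate_out.
  have : 0 <= integrate_out (enum (~: J)%SET) (pweight (beta / 2) gamma) y.
    by apply: (unitmfun_ge0 y); exact: unitmfun_integrate_out.
  move: (integrate_out _ _ y) (integrate_out _ _ y) (integrate_out _ _ y) (integrate_out _ _ y).
  move=> mI f z mJ; set eta := decay_const _ * _ => mJ0 z0 mJz mix.
  (* A vanishing normalization would make the marginal of J equal to 0, since the inverse of 0 is
     0. *)
  have z_gt0 : 0 < z.
    by rewrite lt_neqAle z0 andbT; apply: contraTneq mJz => <-; rewrite invr0 mulr0 ltxx.
  have mJ_gt0 : 0 < mJ by rewrite pmulr_lgt0 ?invr_gt0 in mJz.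
  (* Over the common denominator, the numerator is the quantity bounded by [unnorm_mixing]. *)
  have -> : f / z / (mJ / z) - mI / z = (f * z - mI * mJ) / (mJ * z).
    by field; rewrite !gt_eqF.
  rewrite normrM normfV (ger0_norm (ltW (mulr_gt0 mJ_gt0 z_gt0))).
  rewrite ler_pdivrMr ?mulr_gt0//; apply: le_trans mix _.
  by rewrite le_eqVlt; apply/orP; left; apply/eqP; field; rewrite gt_eqF.
- exact: decay_rate_cvg.
Qed.
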